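(* Let $m\ge0$ be an integer, and let $\alpha>-1$ and $\beta$ be real numbers. Then, as $n\to\infty$ ($n\ge m$), $$n^{-\alpha}\,\hat P^{(\alpha,\beta)}_{m,n}\big(\cos(z/n)\big)\;\longrightarrow\;(-1)^m\binom{m-1-\alpha}{m}\,(z/2)^{-\alpha}J_\alpha(z)$$ uniformly for $z$ in compact subsets of $\mathbb{C}$.
   Context: For real $a,b$ and integer $n\ge0$, $P^{(a,b)}_n(z)=\sum_{s=0}^{n}\binom{n+a}{n-s}\binom{n+b}{s}\left(\frac{z-1}{2}\right)^s\left(\frac{z+1}{2}\right)^{n-s}$ is the Jacobi polynomial, with $\binom{x}{k}=x(x-1)\cdots(x-k+1)/k!$ for real $x$, and $P^{(a,b)}_{-1}:=0$. For $n\ge m\ge0$ and $j=n-m$ the exceptional ($X_m$-)Jacobi polynomial is $$\hat P^{(\alpha,\beta)}_{m,n}=\frac{(-1)^m}{\alpha+1+j}\left(\tfrac12(1+\alpha+\beta+j)(z-1)P^{(-\alpha-1,\beta-1)}_mP^{(\alpha+2,\beta)}_{j-1}+(\alpha+1-m)P^{(-\alpha-2,\beta)}_mP^{(\alpha+1,\beta-1)}_j\right).$$ $J_\alpha$ is the Bessel function of the first kind; $(z/2)^{-\alpha}J_\alpha(z)$ denotes the entire function $\sum_{k\ge0}\frac{(-1)^k (z/2)^{2k}}{k!\,\Gamma(k+\alpha+1)}$. *)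

(* Defs.v *)
From mathcomp Require Import all_boot all_order all_algebra.
From mathcomp Require Import all_classical all_reals all_analysis.
From mathcomp.real_closed Require Export complex.
Set Implicit Arguments.
Unset Strict Implicit.
Unset Printing Implicit Defensive.
Import Order.TTheory GRing.Theory Num.Theory.
Import numFieldNormedType.Exports.
Local Open Scope classical_set_scope.
Local Open Scope ring_scope.
Local Open Scope complex_scope.

(* 'C(x, k) for a real upper argument x. *)
Definition gbinom (R : realType) (x : R) (k : nat) : R :=
  (\prod_(i < k) (x - i%:R)) / k`!%:R.

(* The index is an integer, so that P_{-1} = 0 makes sense; the value 0 at
   indices below -1 is a dummy. *)
Definition jacobi (R : realType) (a b : R) (n : int) : {poly R} :=
  if n is Posz n then
    \sum_(s < n.+1)
      (gbinom (n%:R + a) (n - s) * gbinom (n%:R + b) s) *: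
        ((2^-1 *: ('X - 1)) ^+ s * (2^-1 *: ('X + 1)) ^+ (n - s))
  else 0.

(* Meaningful for m <= n only, as j = n - m is a truncated subtraction. *)
Definition xjacobi (R : realType) (alpha beta : R) (m n : nat) : {poly R} :=
  let j := (n - m)%N in
  ((-1) ^+ m / (alpha + 1 + j%:R)) *:
    ((2^-1 * (1 + alpha + beta + j%:R)) *:
       (('X - 1) * jacobi (- alpha - 1) (beta - 1) m%:Z
                 * jacobi (alpha + 2) beta (j%:Z - 1))
     + (alpha + 1 - m%:R) *:
       (jacobi (- alpha - 2) beta m%:Z
        * jacobi (alpha + 1) (beta - 1) j%:Z)).

(* Evaluation at a complex point of a polynomial with real coefficients. *)
Definition horner_complex (R : realType) (p : {poly R}) (z : R[i]) : R[i] :=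
  (map_poly (real_complex R) p).[z].

Definition expC (R : realType) (z : R[i]) : R[i] :=
  (expR (complex.Re z))%:C * (cos (complex.Im z) +i* sin (complex.Im z)).

Definition cosC (R : realType) (z : R[i]) : R[i] :=
  (expC ('i * z) + expC (- ('i * z))) / 2.

(* Euler's integral: this is the Gamma function on the half-line x > 0 only. *)
Definition Gamma (R : realType) (x : R) : R :=
  \int[lebesgue_measure]_(t in `]0, +oo[) (t `^ (x - 1) * expR (- t)).

(* The entire function (z / 2)^(- alpha) * J_alpha(z); the arguments of Gamma
   are positive when alpha > -1. *)
Definition bessel_entire (R : realType) (alpha : R) (z : R[i]) : R[i] :=
  limn (series (fun k : nat =>
    (-1) ^+ k * (z / 2) ^+ (2 * k)
      / (k`!%:R * (Gamma (k%:R + alpha + 1))%:C) : R[i]^o)).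

(* Main.v *)
Require Import Defs.
From mathcomp Require Import all_boot all_order all_algebra.
From mathcomp Require Import all_classical all_reals all_analysis.
From mathcomp Require Import measurable_realfun ring lra.
Import Order.TTheory GRing.Theory Num.Theory.
Import numFieldNormedType.Exports.
Local Open Scope classical_set_scope.
Local Open Scope ring_scope.
Local Open Scope complex_scope.

(* The exceptional polynomial is a combination of two classical Jacobi
   polynomials of degree about n, with parameters alpha + 2 and alpha + 1,
   multiplied by fixed polynomials that tend to their value at 1.  For the
   classical ones the Mehler-Heine formula is read off the defining sum: after
   division by n^a its s-th term tends to the s-th term of the Bessel series,
   and it is dominated by C D^s / s!, so Tannery's theorem applies; the only
   analytic input is Gamma (n + a + 1) / (n! n^a) -> 1.  The two limits combine
   by the recurrence
     E_a = (a + 1) E_(a+1) - w E_(a+2),   w = (z / 2)^2,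
   of the entire functions E_a = (z / 2)^(- a) J_a.
   All limits are taken along a filter on pairs (z, n) with z -> z0 and
   n -> oo: such joint convergence at every z0 is locally uniform, hence
   uniform on compact sets. *)

Local Notation normc := Normc.normc.

(** * Convergence in R[i] *)

Section ComplexConvergence.
Context {R : realType}.
Implicit Types z : R[i].
Lemma normr_normc (z : R[i]) : `|z| = (normc z)%:C.
Proof. by []. Qed.
Lemma normc_ge0 z : 0 <= normc z.
Proof. by case: z => a b; rewrite sqrtr_ge0. Qed.

(** The norm of [R[i]] takes its values in [R[i]]. Passing to the real modulus [normc] makes
    squeezing and other arguments of real order available. *)
Lemma cvg_normcP {T : Type} (F : set_system T) {FF : Filter F} (f : T -> R[i]^o) (l : R[i]^o) :
  f @ F --> l <-> normc (f t - l) @[t --> F] --> 0.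
Proof.
split.
- move=> /cvgrPdist_lt H; apply/cvgrPdist_lt => e e0.
  have e0' : 0 < e%:C by rewrite ltcR.
  have := H _ e0'; apply: filterS => t.
  by rewrite distrC normr_normc ltcR distrC subr0 ger0_norm ?normc_ge0.
- move=> /cvgrPdist_lt H; apply/cvgrPdist_lt => e e0.
  (* In the partial order of [R[i]] a positive element is real, so the tolerance comes from [R]. *)
  have [r re] : exists r : R, e = r%:C by apply/complex_realP; rewrite realE ltW.
  rewrite re in e0 *; rewrite ltcR in e0.
  have := H _ e0; apply: filterS => t.
  by rewrite distrC subr0 ger0_norm ?normc_ge0 // distrC normr_normc ltcR.
Qed.

Lemma normc_real (x : R) : normc x%:C = `|x|.
Proof. by rewrite /= expr0n /= addr0 sqrtr_sqr. Qed.

Lemma normc_leD z1 z2 : normc (z1 + z2) <= normc z1 + normc z2.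
Proof. exact: le_normcD. Qed.

Lemma normcX z k : normc (z ^+ k) = normc z ^+ k.
Proof. by elim: k => [|k IH]; rewrite ?expr0 ?Normc.normc1 // !exprS Normc.normcM IH. Qed.

Lemma normc_sum I (r : seq I) (P : pred I) (f : I -> R[i]) :
  normc (\sum_(i <- r | P i) f i) <= \sum_(i <- r | P i) normc (f i).
Proof.
elim/big_ind2: _ => //; first by rewrite Normc.normc0.
by move=> x1 x2 y1 y2 h1 h2; apply: (le_trans (normc_leD _ _)); exact: lerD.
Qed.

Lemma normr_Re_le z : `|complex.Re z| <= normc z.
Proof. by case: z => a b /=; rewrite -sqrtr_sqr ler_wsqrtr // lerDl sqr_ge0. Qed.
Lemma normr_Im_le z : `|complex.Im z| <= normc z.
Proof. by case: z => a b /=; rewrite -sqrtr_sqr ler_wsqrtr // lerDr sqr_ge0. Qed.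

Section cvg.
Context {T : Type} {F : set_system T} {FF : Filter F}.

Lemma cvg_real_complex (f : T -> R) (l : R) :
  f @ F --> l -> ((f t)%:C : R[i]^o) @[t --> F] --> (l%:C : R[i]^o).
Proof.
move=> fl; apply/cvg_normcP.
under eq_fun do rewrite -rmorphB normc_real.
rewrite -(@normr0 _ R); apply: cvg_norm; rewrite -(subrr l); exact: cvgB fl (cvg_cst _).
Qed.

Lemma cvg_Re (f : T -> R[i]^o) (l : R[i]^o) :
  f @ F --> l -> complex.Re (f t) @[t --> F] --> complex.Re l.
Proof.
move=> /cvg_normcP /cvgrPdist_lt H; apply/cvgrPdist_lt => e e0.
have := H _ e0; apply: filterS => t.
rewrite distrC subr0 ger0_norm ?normc_ge0 // => /(le_lt_trans (normr_Re_le _)).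
by rewrite distrC; case: (f t) => a b; case: l {H} => c d.
Qed.

Lemma cvg_Im (f : T -> R[i]^o) (l : R[i]^o) :
  f @ F --> l -> complex.Im (f t) @[t --> F] --> complex.Im l.
Proof.
move=> /cvg_normcP /cvgrPdist_lt H; apply/cvgrPdist_lt => e e0.
have := H _ e0; apply: filterS => t.
rewrite distrC subr0 ger0_norm ?normc_ge0 // => /(le_lt_trans (normr_Im_le _)).
by rewrite distrC; case: (f t) => a b; case: l {H} => c d.
Qed.

Lemma cvg_complex (f g : T -> R) (a b : R) : f @ F --> a -> g @ F --> b ->
  (f t +i* g t : R[i]^o) @[t --> F] --> (a +i* b : R[i]^o).
Proof.
move=> fa gb; rewrite (complexE (a +i* b)).
under eq_fun do rewrite [_ +i* _]complexE.
apply: cvgD; first exact: cvg_real_complex.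
by apply: cvgM; [exact: cvg_cst|exact: cvg_real_complex].
Qed.

Lemma cvg_sum_complex {I : Type} (r : seq I) (f : I -> T -> R[i]^o) (l : I -> R[i]^o) :
  (forall i, f i @ F --> l i) ->
  \sum_(i <- r) f i t @[t --> F] --> (\sum_(i <- r) l i : R[i]^o).
Proof.
move=> fl; elim: r => [|i r IH].
  by rewrite big_nil; under eq_fun do rewrite big_nil; exact: cvg_cst.
by rewrite big_cons; under eq_fun do rewrite big_cons; apply: cvgD; [exact: fl|exact: IH].
Qed.

End cvg.

(** Real and imaginary parts are dominated by [B] as well, so both real series converge absolutely;
    the complex one is reassembled from them. *)
Lemma cvg_dominated_series (u : nat -> R[i]) (B : nat -> R) :
  (forall k, normc (u k) <= B k) -> cvgn (series B) ->
  cvgn (series (u : nat -> R[i]^o)).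
Proof.
move=> uB cB.
have cr (v : nat -> R) : (forall k, `|v k| <= B k) -> cvgn (series v).
  move=> vB; apply: normed_cvg; apply: series_le_cvg cB => k //=.
  exact: le_trans (vB k).
have := cr _ (fun k => le_trans (normr_Re_le _) (uB k)).
have := cr _ (fun k => le_trans (normr_Im_le _) (uB k)).
move=> c1 c2; apply/cvg_ex; exists (limn (series (fun k => complex.Re (u k))) +i* limn (series (fun k => complex.Im (u k)))).
suff -> : series (u : nat -> R[i]^o) = fun n => (series (fun k => complex.Re (u k)) n) +i* (series (fun k => complex.Im (u k)) n) by exact: cvg_complex.
apply/funext => n; rewrite /series /=.
elim/big_rec3 : _ => // i a b c _ ->.
by case: (u i).
Qed.

(** Both sums are cut at a common index [S]. The heads are finite sums and converge term by term,
    the remainder of the left sum is at most a tail of [B], and the partial sum of [l] is close to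
    [L]: three errors of e / 3. *)
Lemma tannery {T : Type} {F : set_system T} {FF : ProperFilter F} (p : T -> nat) (a : T -> nat -> R[i]^o)
    (l : nat -> R[i]^o) (B : nat -> R) (L : R[i]^o) :
  p @ F --> \oo -> cvgn (series B) ->
  (forall s, a t s @[t --> F] --> l s) ->
  (\forall t \near F, forall s, (s <= p t)%N -> normc (a t s) <= B s) ->
  series l @ \oo --> L ->
  \sum_(s < (p t).+1) a t s @[t --> F] --> L.
Proof.
move=> poo cB al aB lL; apply/cvg_normcP/cvgrPdist_lt => e e0.
have e3 : 0 < e / 3 by rewrite divr_gt0.
have /cauchy_cvgP/cauchy_seriesP/(_ _ e3) := cB.
case=> -[A1 A2] /= [[N1 _ hN1] [N2 _ hN2]] hA.
move/cvg_normcP/cvgrPdist_lt/(_ _ e3): lL => [N3 _ hN3].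
(* From [S] on, [N1] and [N2] make the blocks of [B] small by the Cauchy criterion, and [N3] brings
   the partial sums of [l] close to [L]. *)
pose S := maxn N1 (maxn N2 N3).
have hS : normc (series l S - L) < e / 3.
  by have := hN3 S; rewrite /= !leq_max leqnn !orbT distrC subr0 ger0_norm ?normc_ge0 //; apply.
have hB m : (S <= m)%N -> \sum_(S <= k < m) B k < e / 3.
  move=> Sm; have := hA (S, m); rewrite /= => H.
  apply: (le_lt_trans (ler_norm _)); apply: H; split => /=; [apply: hN1 | apply: hN2] => /=.
    by rewrite !leq_max leqnn.
  by apply: leq_trans Sm; rewrite !leq_max leqnn !orbT.
have head : normc (\sum_(0 <= s < S) a t s - \sum_(0 <= s < S) l s) @[t --> F] --> (0 : R).
  apply/cvg_normcP.
  exact: cvg_sum_complex.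
have {}head : \forall t \near F, normc (\sum_(0 <= s < S) a t s - \sum_(0 <= s < S) l s) < e / 3.
  by move/cvgrPdist_lt/(_ _ e3): head; apply: filterS => t; rewrite distrC subr0 ger0_norm ?normc_ge0.
have hp : \forall t \near F, (S <= p t)%N by apply: (poo [set k | (S <= k)%N]); exact: nbhs_infty_ge.
near=> t.
have Spt : (S <= (p t).+1)%N.
  by apply: leqW; near: t.
rewrite distrC subr0 ger0_norm ?normc_ge0 //.
rewrite -(big_mkord xpredT) (big_cat_nat _ Spt) //=.
set X := \sum_(0 <= i < S) a t i; set Y := \sum_(S <= _ < _) _.
have -> : X + Y - L = (X - series l S) + (series l S - L) + Y by ring.
apply: (le_lt_trans (normc_leD _ _)).
have -> : e = e / 3 + e / 3 + e / 3 by field.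
apply: ltrD; last first.
  have hY : normc Y <= \sum_(S <= s < (p t).+1) normc (a t s) by exact: normc_sum.
  apply: (le_lt_trans hY).
  apply: le_lt_trans (hB _ Spt).
  rewrite big_nat_cond [leRHS]big_nat_cond; apply: ler_sum => i; rewrite andbT => /andP[_ ip].
  by rewrite ltnS in ip; move: i ip; near: t.
apply: (le_lt_trans (normc_leD _ _)); apply: ltrD => //.
by rewrite /X; near: t; exact: head.
Unshelve. all: by end_near.
Qed.

End ComplexConvergence.

(** * The Gamma function *)

Section GammaFunction.
Context {R : realType}.

Lemma is_derive_Nexp (t : R) : is_derive t 1 (fun t => - expR (- t)) (expR (- t)).
Proof.
have h : is_derive t 1 (expR \o -%R) (expR (- t) * -1).
  by apply: is_derive1_comp; apply: is_deriveN.
by have := is_deriveN h; rewrite mulrN1 opprK.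
Qed.

Lemma continuous_powR (y t : R) : 0 < t -> {for t, continuous (fun t : R => t `^ y)}.
Proof.
move=> t0; apply: (@differentiable_continuous _ R^o R^o); apply/derivable1_diffP.
by apply: derivable_powR; rewrite in_itv /= andbT.
Qed.

Implicit Types x y t : R.
Notation mu := lebesgue_measure.

(** Kept in the extended reals, so that monotone convergence, comparison and the functional equation
    can be used before finiteness is known. *)
Definition gamma_int (x : R) : \bar R :=
  (\int[mu]_(t in `]0%R, +oo[) (t `^ (x - 1) * expR (- t))%:E)%E.

Lemma GammaE x : Gamma x = fine (gamma_int x).
Proof. by []. Qed.

Lemma continuous_gamma_integrand x : {in `]0, +oo[%classic, continuous (fun t => t `^ (x - 1) * expR (- t) : R)}.
Proof.
move=> t; rewrite inE /= in_itv /= andbT => t0.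
apply: cvgM.
  exact: continuous_powR.
by apply: continuous_comp; [exact: continuousN|exact: continuous_expR].
Qed.

Lemma measurable_gamma_integrand x : measurable_fun (`]0, +oo[ : set R) (fun t => t `^ (x - 1) * expR (- t) : R).
Proof.
apply: open_continuous_measurable_fun; first exact: interval_open.
exact: continuous_gamma_integrand.
Qed.

Lemma measurable_gamma_E x : measurable_fun (`]0, +oo[ : set R) (fun t => (t `^ (x - 1) * expR (- t))%:E).
Proof. by apply/measurable_EFinP; exact: measurable_gamma_integrand. Qed.

Lemma gamma_integrand_ge0 x t : 0 <= t `^ (x - 1) * expR (- t).
Proof. by rewrite mulr_ge0 ?powR_ge0 ?expR_ge0. Qed.

Lemma gamma_int_ge0 x : (0 <= gamma_int x)%E.
Proof. by apply: integral_ge0 => t _; rewrite lee_fin gamma_integrand_ge0. Qed.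

(** Compact intervals exhausting the half-line and avoiding the singularity at 0, fit for
    integration by parts. The shift by 2 keeps the lower end strictly below the upper one at n = 0
    as well. *)
Definition gamma_box (n : nat) : set R := `[n.+2%:R^-1, n.+2%:R].

Lemma gamma_box_lim x :
  (\int[mu]_(t in gamma_box n) (t `^ (x - 1) * expR (- t))%:E)%E @[n --> \oo] --> gamma_int x.
Proof.
have -> : gamma_int x = (\int[mu]_(t in \bigcup_n gamma_box n) (t `^ (x - 1) * expR (- t))%:E)%E.
  congr (integral _ _ _); apply/seteqP; split => t /=; rewrite in_itv /= ?andbT.
    (* An index above t + 1/t bounds t and 1/t at once, which places t in the box. *)
    move=> t0; pose k := Num.truncn (t + t^-1).
    have kt : t + t^-1 < k.+1%:R by apply: truncnS_gt; rewrite addr_ge0 // ?invr_ge0 ltW.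
    have kk : t + t^-1 <= k.+2%:R by rewrite ltW // (lt_trans kt) // ltr_nat.
    exists k => //; rewrite /gamma_box /= in_itv /=; apply/andP; split.
      rewrite -[leRHS]invrK lef_pV2 ?posrE ?invr_gt0 //.
      by rewrite (le_trans _ kk) // lerDr ltW.
    by rewrite (le_trans _ kk) // lerDl invr_ge0 ltW.
  move=> [n _]; rewrite /gamma_box /= in_itv /= => /andP[+ _].
  by apply: lt_le_trans; rewrite invr_gt0.
have sub n : gamma_box n `<=` `]0, +oo[.
  move=> t; rewrite /gamma_box /= !in_itv /= andbT => /andP[+ _].
  by apply: lt_le_trans; rewrite invr_gt0.
apply: ge0_nondecreasing_set_cvg_integral.
- apply/nondecreasing_seqP => n; rewrite subsetEset /gamma_box; apply: subset_itv; rewrite bnd_simp.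
    by rewrite lef_pV2 ?posrE // ler_nat.
  by rewrite ler_nat.
- by move=> n; exact: measurable_itv.
- move=> n; apply/measurable_EFinP.
  apply: measurable_funS (measurable_gamma_integrand x) => //; exact: measurable_itv.
- by move=> n t _; rewrite lee_fin gamma_integrand_ge0.
Qed.

(** For an integer k >= x and t >= 1, the bound exp t >= t^(k+1) / (k+1)! leaves at most (k+1)! /
    t. *)
Lemma cvg_powR_expRN x : t `^ x * expR (- t) @[t --> +oo] --> 0.
Proof.
pose k := (Num.truncn `|x|).+1.
have xk : x <= k%:R by rewrite (le_trans (ler_norm _)) // ltW // truncnS_gt.
have H : (k.+1)`!%:R * t^-1 @[t --> +oo] --> (0 : R).
  rewrite -(mulr0 (k.+1)`!%:R); apply: cvgM; first exact: cvg_cst.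
  apply/gtr0_cvgV0; [exact: nbhs_pinfty_gt|exact: cvg_id].
apply: (squeeze_cvgr _ (cvg_cst 0) H).
near=> t.
have t1 : 1 <= t by near: t; exact: nbhs_pinfty_ge.
have t0 : 0 < t by exact: lt_le_trans t1.
rewrite mulr_ge0 ?powR_ge0 ?expR_ge0 //=.
rewrite expRN ler_pdivrMr ?expR_gt0 // mulrAC ler_pdivlMr //.
have := expR_ge1Dxn k (ltW t0); rewrite -lerBrDl => h.
have h2 : t ^+ k.+1 <= (k.+1)`!%:R * expR t.
  rewrite mulrC -ler_pdivrMr ?ltr0n ?fact_gt0 //; apply: (le_trans h); lra.
apply: le_trans h2; rewrite exprSr ler_wpM2r ?(ltW t0) //.
by rewrite -powR_mulrn ?(ltW t0) // ler_powR.
Unshelve. all: by end_near.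
Qed.

(** Integration by parts on each box, then passage to the limit. As an identity of extended reals it
    presupposes no finiteness, and the proof of finiteness relies on it. *)
Lemma gamma_int_rec x : 0 < x -> gamma_int (x + 1) = (x%:E * gamma_int x)%E.
Proof.
move=> x0.
(* The boundary terms of the integration by parts; they vanish at both ends in the limit. *)
pose d (n : nat) : R := - (n.+2%:R `^ x * expR (- n.+2%:R)) + (n.+2%:R^-1) `^ x * expR (- n.+2%:R^-1).
have step n : (\int[mu]_(t in gamma_box n) (t `^ ((x + 1) - 1) * expR (- t))%:E =
   (d n)%:E + x%:E * \int[mu]_(t in gamma_box n) (t `^ (x - 1) * expR (- t))%:E)%E.
  rewrite addrK /gamma_box.
  have pos t : n.+2%:R^-1 <= t -> 0 < t by apply: lt_le_trans; rewrite invr_gt0.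
  have ab : n.+2%:R^-1 < n.+2%:R :> R.
    by rewrite (@lt_trans _ _ 1) // ?invf_lt1 // ltr1n.
  have ce t : {for t, continuous (fun t : R => expR (- t))}.
    by apply: continuous_comp; [exact: continuousN|exact: continuous_expR].
  have cp y t : 0 < t -> {for t, continuous (fun t : R => t `^ y)}.
    exact: continuous_powR.
  have dp t : 0 < t -> derivable (fun t : R => t `^ x) t 1.
    by move=> t0; apply: derivable_powR; rewrite in_itv /= andbT.
  have lt0 t : t \in `]n.+2%:R^-1, n.+2%:R[ -> 0 < t.
    by rewrite in_itv /= => /andP[/ltW/pos].
  rewrite (@integration_by_parts R (fun t => t `^ x) (fun t => - expR (- t)) (fun t => x * t `^ (x - 1)) (fun t => expR (- t))) //.
  - set I := (X in (x%:E * X)%E).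
    have -> : (x%:E * I = - ((- x)%:E * I))%E by rewrite EFinN mulNe oppeK.
    rewrite /I -integralZl //=; last first.
      apply: continuous_compact_integrable; first exact: segment_compact.
      apply: continuous_in_subspaceT => t; rewrite inE /= in_itv /= => /andP[/pos t0 _].
      by apply: continuous_gamma_integrand; rewrite inE /= in_itv /= t0.
    congr (_ - _)%E; last by apply: eq_integral => t _; rewrite -EFinM; congr EFin; ring.
    by rewrite /d; congr EFin; ring.
  - apply: continuous_in_subspaceT => t; rewrite inE /= in_itv /= => /andP[/pos t0 _].
    by apply: cvgM; [exact: cvg_cst|exact: cp].
  - split.
    + by move=> t /lt0; exact: dp.
    + apply/cvg_at_right_filter; apply: cp; by rewrite invr_gt0.
    + apply/cvg_at_left_filter; exact: cp.
  - by move=> t /lt0 t0; rewrite powR_derive1 // in_itv /= t0.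
  - by apply: continuous_subspaceT => t; exact: ce.
  - split.
    + move=> t _; apply: derivableN; exact: ex_derive.
    + apply/cvg_at_right_filter; apply: cvgN; exact: ce.
    + apply/cvg_at_left_filter; apply: cvgN; exact: ce.
  - move=> t _; rewrite derive1E; apply: derive_val; exact: is_derive_Nexp.
have d0 : d n @[n --> \oo] --> 0.
  have ninf : (n.+2%:R : R) @[n --> \oo] --> +oo.
    by have := @cvgr_idn R; rewrite -(cvg_shiftn 2) /=; under eq_fun do rewrite addn2.
  rewrite -[in X in _ --> X](addr0 0) -{1}oppr0; apply: cvgD.
    apply: cvgN; exact: (cvg_comp _ _ ninf (cvg_powR_expRN x)).
  have i0 : (n.+2%:R : R)^-1 @[n --> \oo] --> 0.
    by apply/gtr0_cvgV0 => //; exact: nearW.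
  rewrite -[in X in _ --> X](mul0r (expR (-0))); apply: cvgM.
    (* [powR_cvg0] is a limit from the right at 0, so the positivity of the points 1 / (n+2) has to
       be supplied. *)
    apply: cvg_comp (powR_cvg0 x0) => P /= Pn.
    by apply: (@filterS _ \oo _ (fun k => 0 < k.+2%:R^-1 :> R -> P k.+2%:R^-1) _ _ (i0 _ Pn)) => k; apply; rewrite invr_gt0.
  apply: continuous_cvg; first exact: continuous_expR.
  exact: cvgN.
have h1 := gamma_box_lim (x + 1).
have h2 := gamma_box_lim x.
have h3 : (\int[mu]_(t in gamma_box n) (t `^ (x + 1 - 1) * expR (- t))%:E)%E @[n --> \oo] --> (x%:E * gamma_int x)%E.
  rewrite (eq_cvg _ _ step) -[in X in _ --> X](add0e (x%:E * _)%E).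
  by apply: cvgeD; [exact: fin_num_adde_defr|by apply: cvg_EFin; [exact: nearW|exact: d0]|exact: cvgeZl].
exact: (cvg_unique _ h1 h3).
Qed.

Lemma gamma_int1 : gamma_int 1 = 1%E.
Proof.
rewrite /gamma_int.
under eq_integral do rewrite subrr powRr0 mul1r.
have H : {within `[0%R, +oo[, continuous (fun t : R => expR (- t))}.
  apply: continuous_subspaceT => t.
  by apply: continuous_comp; [exact: continuousN|exact: continuous_expR].
rewrite integral_itv_obnd_cbnd; last first.
  apply/measurable_EFinP; have := measurable_gamma_integrand 1.
  by apply: eq_measurable_fun => t _; rewrite subrr powRr0 mul1r.
rewrite (@ge0_continuous_FTC2y _ (fun t => expR (- t)) (fun t => - expR (- t)) 0 0) //.
- by rewrite oppr0 expR0 EFinN oppeK add0e.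
- rewrite -oppr0; apply: cvgN; exact: cvgr_expR.
- apply: cvgN; apply/cvg_at_right_filter.
  by apply: continuous_comp; [exact: continuousN|exact: continuous_expR].
- by move=> t _; rewrite derive1E; apply: derive_val; exact: is_derive_Nexp.
Qed.

(** On [1, 2] the integrand lies below the sum of those for 1 and 2, both of which have finite
    integral. The functional equation carries this down to ]0, 1] and then up through the intervals
    ]n, n+1]. *)
Lemma gamma_int_fin x : 0 < x -> gamma_int x \is a fin_num.
Proof.
have dom y z : (forall t, 0 < t -> t `^ (y - 1) <= 1 + t `^ (z - 1)) ->
    gamma_int z \is a fin_num -> gamma_int y \is a fin_num.
  move=> H fz; rewrite ge0_fin_numE ?gamma_int_ge0 //.
  apply: (@le_lt_trans _ _ (gamma_int 1 + gamma_int z)%E); last first.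
    by rewrite gamma_int1 lte_add_pinfty ?ltry // -ge0_fin_numE // gamma_int_ge0.
  rewrite /gamma_int -ge0_integralD //=; last 4 first.
  - by move=> t _; rewrite lee_fin gamma_integrand_ge0.
  - exact: measurable_gamma_E.
  - by move=> t _; rewrite lee_fin gamma_integrand_ge0.
  - exact: measurable_gamma_E.
  apply: ge0_le_integral => //=.
  - by move=> t _; rewrite lee_fin gamma_integrand_ge0.
  - exact: measurable_gamma_E.
  - apply: emeasurable_funD; exact: measurable_gamma_E.
  move=> t; rewrite in_itv /= andbT => t0.
  by rewrite lee_fin subrr powRr0 -mulrDl ler_wpM2r ?expR_ge0 // H.
have f1 : gamma_int 1 \is a fin_num by rewrite gamma_int1.
have f2 : gamma_int (1 + 1) \is a fin_num by rewrite (gamma_int_rec 1) // gamma_int1 mule1.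
have f12 y : 1 <= y <= 1 + 1 -> gamma_int y \is a fin_num.
  move=> /andP[y1 y2]; apply: (dom _ _ _ f2) => t t0.
  rewrite addrK powRr1 ?(ltW t0) //.
  have [t1|t1] := leP t 1.
    have : t `^ (y - 1) <= t `^ 0 by apply: ger_powR; rewrite ?t0 // subr_ge0.
    by rewrite powRr0 => /le_trans; apply; rewrite lerDl ltW.
  have : t `^ (y - 1) <= t `^ 1 by apply: ler_powR; [exact: ltW|lra].
  by rewrite powRr1 ?(ltW t0) // => /le_trans; apply; rewrite lerDr.
(* Here y times the integral is finite with y > 0, which excludes the value +oo. *)
have f01 y : 0 < y <= 1 -> gamma_int y \is a fin_num.
  move=> /andP[y0 y1]; have := f12 (y + 1) _.
  rewrite (gamma_int_rec y y0) => h.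
  have {h} : (y%:E * gamma_int y)%E \is a fin_num by apply: h; apply/andP; split; lra.
  rewrite [in X in _ -> X]ge0_fin_numE ?gamma_int_ge0 // ltNge leye_eq => h; apply/negP => /eqP E.
  by move: h; rewrite E mulry gtr0_sg // mul1e.
have rec n y : n%:R < y <= n.+1%:R -> gamma_int y \is a fin_num.
  elim: n y => [|n IH] y; first exact: f01.
  move=> h; have -> : y = (y - 1) + 1 by rewrite subrK.
  move/andP : h => [h1 h2].
  rewrite (gamma_int_rec (y - 1)); last by rewrite subr_gt0 (le_lt_trans _ h1) // ler1n.
  have f : gamma_int (y - 1) \is a fin_num.
    apply: IH; rewrite -!natr1 in h1 h2 *; apply/andP; split; lra.
  exact: fin_numM.
move=> x0; pose n := Num.truncn x.
have nx : n%:R <= x < n.+1%:R by apply: truncn_itv; exact: ltW.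
(* [truncn] gives x in [n, n+1[ while [rec] works on ]n, n+1]; an integer x therefore belongs to the
   preceding interval. *)
have [e|ne] := eqVneq (n%:R) x.
  move: nx e; case: n => [|m] nx e; first by exfalso; move: x0; rewrite -[x]e ltxx.
  by apply: (rec m); rewrite -e lexx ltr_nat ltnSn.
apply: (rec n); move/andP: nx => [h1 h2]; by rewrite lt_neqAle ne h1 /= ltW.
Qed.

Lemma Gamma1 : Gamma (1 : R) = 1.
Proof. by rewrite GammaE gamma_int1. Qed.

Lemma GammaS x : 0 < x -> Gamma (x + 1) = x * Gamma x.
Proof.
move=> x0; rewrite !GammaE (gamma_int_rec x) //.
by rewrite -(fineK (gamma_int_fin x x0)).
Qed.

(* The tangent inequality at [y] for the concave map [t |-> t `^ x], integrated
   against [t `^ (y - 1) * expR (- t)]. *)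
Lemma Gamma_le_powR x y : 0 <= x <= 1 -> 0 < y -> Gamma (y + x) <= y `^ x * Gamma y.
Proof.
move=> /andP[x0 x1] y0.
have yx0 : 0 < y + x by lra.
have y10 : 0 < y + 1 by lra.
have key t : 0 < t -> t `^ (y + x - 1) <= (1 - x) * y `^ x * t `^ (y - 1) + x * y `^ (x - 1) * t `^ (y + 1 - 1).
  move=> t0.
  have -> : y + x - 1 = (y - 1) + x by ring.
  have -> : y + 1 - 1 = (y - 1) + 1 by ring.
  rewrite !(@powRD _ t (y - 1)) ?(gt_eqF t0) ?implybT // powRr1 ?(ltW t0) //.
  rewrite [X in _ <= _ + X]mulrCA [X in _ <= X + _]mulrC -mulrDr ler_wpM2l ?powR_ge0 //.
  (* Both [e1] and [e2] are instances of 1 + u <= exp u, at u = - x L and u = (1 - x) L. With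
     weights 1 - x and x the terms in L cancel and t^x remains. *)
  pose L := ln t - ln y.
  have e1 : t `^ x * (1 - x * L) <= y `^ x.
    have -> : y `^ x = t `^ x * expR (- (x * L)).
      by rewrite /powR (gt_eqF t0) (gt_eqF y0) -expRD /L; congr expR; ring.
    by rewrite ler_wpM2l ?powR_ge0 // expR_ge1Dx.
  have e2 : t `^ x * (1 + (1 - x) * L) <= y `^ (x - 1) * t.
    have -> : y `^ (x - 1) * t = t `^ x * expR ((1 - x) * L).
      by rewrite -{1}(lnK t0) /powR (gt_eqF t0) (gt_eqF y0) -!expRD /L; congr expR; ring.
    by rewrite ler_wpM2l ?powR_ge0 // expR_ge1Dx.
  have -> : t `^ x = (1 - x) * (t `^ x * (1 - x * L)) + x * (t `^ x * (1 + (1 - x) * L)) by ring.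
  by rewrite -mulrA; apply: lerD; apply: ler_wpM2l => //; rewrite subr_ge0.
have : (gamma_int (y + x) <= ((1 - x) * y `^ x)%:E * gamma_int y + (x * y `^ (x - 1))%:E * gamma_int (y + 1))%E.
  rewrite /gamma_int -!ge0_integralZl_EFin //=; last 6 first.
  - by move=> t _; rewrite lee_fin gamma_integrand_ge0.
  - exact: measurable_gamma_E.
  - by rewrite mulr_ge0 ?powR_ge0.
  - by move=> t _; rewrite lee_fin gamma_integrand_ge0.
  - exact: measurable_gamma_E.
  - by rewrite mulr_ge0 ?powR_ge0 // subr_ge0.
  rewrite -ge0_integralD //=; last 4 first.
  - move=> t _; rewrite lee_fin; apply: mulr_ge0; last exact: gamma_integrand_ge0.
    by rewrite mulr_ge0 ?powR_ge0 // subr_ge0.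
  - apply: measurable_funeM; exact: measurable_gamma_E.
  - move=> t _; rewrite lee_fin; apply: mulr_ge0; last exact: gamma_integrand_ge0.
    by rewrite mulr_ge0 ?powR_ge0.
  - apply: measurable_funeM; exact: measurable_gamma_E.
  apply: ge0_le_integral => //=.
  - by move=> t _; rewrite lee_fin gamma_integrand_ge0.
  - exact: measurable_gamma_E.
  - by apply: emeasurable_funD; apply: measurable_funeM; exact: measurable_gamma_E.
  move=> t; rewrite in_itv /= andbT => t0.
  by rewrite lee_fin !mulrA -mulrDl ler_wpM2r ?expR_ge0 // key.
rewrite -(fineK (gamma_int_fin _ yx0)) -(fineK (gamma_int_fin _ y0)) -(fineK (gamma_int_fin _ y10)).
rewrite -!GammaE lee_fin => /le_trans; apply.
rewrite GammaS // mulrA -mulrDl ler_wpM2r //; first by rewrite GammaE fine_ge0 // gamma_int_ge0.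
have -> : x * y `^ (x - 1) * y = x * y `^ x.
  rewrite -mulrA -{2}(powRr1 (ltW y0)) -powRD ?subrK //.
  by rewrite (gt_eqF y0) implybT.
by rewrite -mulrDl subrK mul1r.
Qed.

(** A zero at x would propagate to x + 1. The integer n + 2 lies at distance at most 1 above x + 1,
    so [Gamma_le_powR] would give Gamma (n + 2) <= 0, against its positivity at integers. *)
Lemma Gamma_gt0 x : 0 < x -> 0 < Gamma x.
Proof.
move=> x0.
have ge0 y : 0 <= Gamma y by rewrite GammaE fine_ge0 // gamma_int_ge0.
have nat_gt0 n : 0 < Gamma (n.+1%:R : R).
  elim: n => [|n IH]; first by rewrite Gamma1.
  by rewrite -natr1 GammaS // mulr_gt0.
rewrite lt_neqAle ge0 andbT eq_sym; apply/eqP => G0.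
have rec n : Gamma (x + n%:R) = 0.
  elim: n => [|n IH]; first by rewrite addr0.
  by rewrite -natr1 addrA GammaS ?IH ?mulr0 // ltr_wpDr.
pose n := Num.truncn x.
have /andP[h1 h2] : n%:R <= x < n.+1%:R by apply: truncn_itv; exact: ltW.
have hx : 0 < x + 1 by lra.
have := @Gamma_le_powR (n.+2%:R - (x + 1)) (x + 1) _ hx.
have -> : x + 1 + (n.+2%:R - (x + 1)) = n.+2%:R by ring.
rewrite (rec 1%N) mulr0 => h.
have := nat_gt0 n.+1; rewrite ltNge h //.
rewrite -!natr1 in h2 *; apply/andP; split; lra.
Qed.
End GammaFunction.

(** * Asymptotics of the coefficients *)

Section GammaAsymptotics.
Context {R : realType}.
Implicit Types a b : R.

Lemma cvg_to_eq {T : Type} {F : set_system T} {V : topologicalType} {f : T -> V} {l l' : V} :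
  l = l' -> f @ F --> l -> f @ F --> l'.
Proof. by move=> ->. Qed.

Lemma Gamma_natS n : Gamma (n%:R + 1 : R) = n`!%:R.
Proof.
elim: n => [|n IH]; first by rewrite add0r Gamma1 fact0.
by rewrite GammaS ?ltr_wpDl // -natr1 IH factS natrM -natr1.
Qed.

Definition gamma_ratio a (n : nat) : R := Gamma (n%:R + a + 1) / (n`!%:R * n%:R `^ a).

Lemma gamma_ratioS a n : 0 <= a -> (0 < n)%N ->
  gamma_ratio (a + 1) n = gamma_ratio a n * (1 + (a + 1) * n%:R^-1).
Proof.
move=> a0 n0; rewrite /gamma_ratio addrA.
have nR : 0 < n%:R :> R by rewrite ltr0n.
rewrite GammaS; last by rewrite ltr_wpDl // addr_ge0.
rewrite powRD ?(gt_eqF nR) ?implybT // powRr1 ?(ltW nR) //.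
have h1 : n%:R `^ a != 0 by rewrite gt_eqF // powR_gt0.
have h2 : n`!%:R != 0 :> R by rewrite pnatr_eq0 -lt0n fact_gt0.
by field; rewrite h1 h2 gt_eqF.
Qed.

Lemma cvg_harmonic0 : (n%:R : R)^-1 @[n --> \oo] --> 0.
Proof. by apply/gtr0_cvgV0; [near=> n; rewrite ltr0n; near: n; exact: nbhs_infty_gt|exact: cvgr_idn]. Unshelve. all: by end_near. Qed.

(** [Gamma_le_powR] is used twice: the step a from n + 1 bounds Gamma (n + a + 1) above, and the
    step 1 - a from n + a + 1 to n + 2 bounds it below. The ratio is thereby squeezed between 1 -
    1/n and 1 + 1/n. *)
Lemma gamma_ratio_cvg01 a : 0 <= a <= 1 -> gamma_ratio a n @[n --> \oo] --> (1 : R).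
Proof.
move=> /andP[a0 a1].
have L : 1 - (n%:R : R)^-1 @[n --> \oo] --> (1 : R).
  by rewrite -[in X in _ --> X](subr0 1); apply: cvgB; [exact: cvg_cst|exact: cvg_harmonic0].
have U : 1 + (n%:R : R)^-1 @[n --> \oo] --> (1 : R).
  by rewrite -[in X in _ --> X](addr0 1); apply: cvgD; [exact: cvg_cst|exact: cvg_harmonic0].
apply: (squeeze_cvgr _ L U); near=> n.
have n0 : (0 < n)%N by near: n; exact: nbhs_infty_gt.
have nR : 0 < n%:R :> R by rewrite ltr0n.
have n1 : 0 < n%:R + 1 :> R by rewrite ltr_wpDl.
have f0 : 0 < n`!%:R :> R by rewrite ltr0n fact_gt0.
have p0 : 0 < n%:R `^ a :> R by rewrite powR_gt0.
have fp : 0 < n`!%:R * n%:R `^ a :> R by rewrite mulr_gt0.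
have up : Gamma (n%:R + a + 1 : R) <= (n%:R + 1) `^ a * n`!%:R.
  have := @Gamma_le_powR R a (n%:R + 1) _ n1.
  by rewrite Gamma_natS addrAC; apply; rewrite a0.
have lo : (n%:R + 1) * n`!%:R <= (n%:R + a + 1) `^ (1 - a) * Gamma (n%:R + a + 1 : R).
  have h : 0 < n%:R + a + 1 :> R by rewrite ltr_wpDl // addr_ge0.
  have := @Gamma_le_powR R (1 - a) (n%:R + a + 1) _ h.
  have -> : n%:R + a + 1 + (1 - a) = (n%:R + 1) + 1 :> R by ring.
  rewrite GammaS // Gamma_natS; apply; apply/andP; split; lra.
apply/andP; split.
  rewrite /gamma_ratio ler_pdivlMr //.
  pose q := n%:R + a + 1.
  have q0 : 0 < q by rewrite /q ltr_wpDl // addr_ge0.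
  have qn : n%:R `^ a <= q `^ a.
    by apply: ge0_ler_powR; rewrite ?nnegrE ?(ltW q0) ?(ltW nR) // /q -addrA lerDl addr_ge0.
  have qa : q `^ (1 - a) * q `^ a = q.
    by rewrite -powRD ?subrK ?powRr1 ?(ltW q0) // (gt_eqF q0) implybT.
  rewrite -(ler_pM2l (powR_gt0 (1 - a) q0)); apply: le_trans lo.
  have h : q `^ (1 - a) * n%:R `^ a <= q by rewrite -[leRHS]qa ler_wpM2l ?powR_ge0.
  have i0 : 0 <= 1 - n%:R^-1 :> R by rewrite subr_ge0 invf_le1 // ler1n.
  rewrite [leRHS]mulrC.
  have -> : q `^ (1 - a) * ((1 - n%:R^-1) * (n`!%:R * n%:R `^ a)) =
    n`!%:R * ((1 - n%:R^-1) * (q `^ (1 - a) * n%:R `^ a)) by ring.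
  rewrite ler_wpM2l ?(ltW f0) //.
  apply: (@le_trans _ _ ((1 - n%:R^-1) * q)); first by rewrite ler_wpM2l.
  (* What remains is (1 - 1/n) (n + a + 1) <= n + 1, that is, a - (a + 1) / n <= 1, which follows
     from a <= 1. *)
  rewrite /q; have : n%:R * n%:R^-1 = 1 :> R by rewrite divff ?gt_eqF.
  have : 0 < n%:R^-1 :> R by rewrite invr_gt0.
  by nra.
rewrite /gamma_ratio ler_pdivrMr //; apply: (le_trans up).
rewrite mulrCA mulrC ler_wpM2l ?(ltW f0) //.
have -> : n%:R + 1 = (1 + n%:R^-1) * n%:R :> R by rewrite mulrDl mul1r mulVf ?gt_eqF // addrC.
have i1 : 1 <= 1 + n%:R^-1 :> R by rewrite lerDl invr_ge0 ltW.
rewrite powRM ?(ltW nR) ?(le_trans _ i1) // ler_wpM2r ?(ltW p0) //.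
exact: ler1_powR.
Unshelve. all: by end_near.
Qed.

(** Raising a by 1 multiplies the ratio by 1 + (a + 1) / n, which tends to 1; induction on the
    integer part of a starts from [0, 1]. *)
Lemma gamma_ratio_cvg a : 0 <= a -> gamma_ratio a n @[n --> \oo] --> (1 : R).
Proof.
have H k x : 0 <= x <= 1 -> gamma_ratio (x + k%:R) n @[n --> \oo] --> (1 : R).
  move=> x01; elim: k => [|k IH]; first by rewrite addr0; exact: gamma_ratio_cvg01.
  have G : gamma_ratio (x + k%:R) n * (1 + (x + k%:R + 1) * n%:R^-1) @[n --> \oo] --> (1 : R).
    have E : 1 * (1 + (x + k%:R + 1) * 0) = 1 by rewrite mulr0 addr0 mulr1.
    apply: (cvg_to_eq E); apply: cvgM; first exact: IH.
    apply: cvgD; first exact: cvg_cst.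
    by apply: cvgM; [exact: cvg_cst|exact: cvg_harmonic0].
  apply: cvg_trans G; apply: near_eq_cvg; near=> n.
  rewrite -natr1 addrA gamma_ratioS //.
    by case/andP: x01 => x0 _; rewrite addr_ge0.
  by near: n; exact: nbhs_infty_gt.
move=> a0; pose k := Num.truncn a.
have /andP[h1 h2] : k%:R <= a < k.+1%:R by exact: truncn_itv.
have := H k (a - k%:R); rewrite subrK; apply.
rewrite -natr1 in h2; apply/andP; split; lra.
Unshelve. all: by end_near.
Qed.

(** The numerator is the product of the factors picked up by the functional equation on the way from
    Gamma (s + a + 1) to Gamma (p + a + 1). *)
Lemma gbinom_Gamma a p s : -1 < a -> (s <= p)%N ->
  gbinom (p%:R + a) (p - s) = Gamma (p%:R + a + 1) / (Gamma (s%:R + a + 1) * (p - s)`!%:R).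
Proof.
move=> a1 sp.
have key k (x : R) : 0 < x + 1 -> (\prod_(i < k) (x + k%:R - i%:R)) * Gamma (x + 1) = Gamma (x + k%:R + 1).
  move=> x0; elim: k => [|k IH]; first by rewrite big_ord0 mul1r addr0.
  rewrite big_ord_recl /= subr0 (_ : x + k.+1%:R + 1 = (x + k%:R + 1) + 1); last by rewrite -natr1; ring.
  rewrite (GammaS (x + k%:R + 1)); last by rewrite addrAC ltr_wpDr.
  rewrite -IH mulrA; congr (_ * _ * _); first by rewrite -natr1 addrA.
  apply: eq_bigr => i _; rewrite /bump /= add1n -!natr1; ring.
have x0 : 0 < (s%:R + a) + 1 by rewrite -addrA ltr_wpDl // -ltrBlDr sub0r.
have := key (p - s)%N _ x0.
have -> : s%:R + a + (p - s)%:R = p%:R + a by rewrite natrB //; ring.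
move=> <-; rewrite /gbinom.
have := Gamma_gt0 _ x0; have : 0 < (p - s)`!%:R :> R by rewrite ltr0n fact_gt0.
move=> /gt_eqF h1 /gt_eqF h2; field; by rewrite h1 h2.
Qed.

(** The numerator of binom(p + b, s) scaled by p^s. For b = 0 and s <= p it is p! / ((p - s)!
    p^s). *)
Definition ratio_prod b s (p : nat) : R := \prod_(i < s) ((p%:R + b - i%:R) / p%:R).

Lemma ratio_prodE b s p : (0 < p)%N ->
  \prod_(i < s) (p%:R + b - i%:R) = ratio_prod b s p * p%:R ^+ s.
Proof.
move=> p0; rewrite /ratio_prod prodf_div prodr_const card_ord divfK //.
by rewrite expf_neq0 // pnatr_eq0 -lt0n.
Qed.

Lemma ratio_prod_cvg b s : ratio_prod b s p @[p --> \oo] --> (1 : R).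
Proof.
elim: s => [|s IH].
  have -> : ratio_prod b 0 = cst 1 by apply/funext => p; rewrite /ratio_prod big_ord0.
  exact: cvg_cst.
have -> : ratio_prod b s.+1 = fun p => ratio_prod b s p * ((p%:R + b - s%:R) / p%:R).
  by apply/funext => p; rewrite /ratio_prod big_ord_recr.
apply: (cvg_to_eq (mulr1 (1 : R))); apply: cvgM; first exact: IH.
have G : 1 + (b - s%:R) * p%:R^-1 @[p --> \oo] --> (1 : R).
  have E : 1 + (b - s%:R) * 0 = 1 by rewrite mulr0 addr0.
  apply: (cvg_to_eq E).
  apply: cvgD; first exact: cvg_cst.
  by apply: cvgM; [exact: cvg_cst|exact: cvg_harmonic0].
apply: cvg_trans G; apply: near_eq_cvg; near=> p.
have p0 : p%:R != 0 :> R by rewrite pnatr_eq0 -lt0n; near: p; exact: nbhs_infty_gt.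
by rewrite /=; field.
Unshelve. all: by end_near.
Qed.

(** Each factor satisfies |p - i + b| <= p + |b| <= (1 + |b|) p. The bound does not depend on p, as
    domination requires. *)
Lemma ratio_prod_le b s p : (0 < p)%N -> (s <= p)%N -> `|ratio_prod b s p| <= (1 + `|b|) ^+ s.
Proof.
move=> p0 sp; rewrite /ratio_prod normr_prod -[X in _ ^+ X]card_ord -prodr_const.
have pR : 0 < p%:R :> R by rewrite ltr0n.
apply: ler_prod => i _; rewrite normr_ge0 /= normrM normfV (ger0_norm (ltW pR)) ler_pdivrMr //.
rewrite addrAC; apply: (le_trans (ler_normD _ _)); rewrite mulrDl mul1r lerD //.
  have ip : i%:R <= p%:R :> R by rewrite ler_nat (leq_trans (ltnW (ltn_ord i))).
  by rewrite ger0_norm ?subr_ge0 // lerBlDr lerDl.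
by rewrite ler_peMr // ler1n.
Qed.

(** Isolates the Bessel coefficient 1 / (s! Gamma (s + a + 1)) from three factors tending to 1. The
    power p^(2s) is left to be absorbed by ((x - 1) / 2)^s. *)
Lemma jacobi_coef a b p s : 0 <= a -> (0 < p)%N -> (s <= p)%N ->
  p%:R `^ (- a) * (gbinom (p%:R + a) (p - s) * gbinom (p%:R + b) s) =
  gamma_ratio a p * ratio_prod 0 s p * ratio_prod b s p / (s`!%:R * Gamma (s%:R + a + 1)) * (p%:R ^+ 2) ^+ s.
Proof.
move=> a0 p0 sp; rewrite gbinom_Gamma //; last by lra.
have pR : 0 < p%:R :> R by rewrite ltr0n.
rewrite {1}/gbinom (ratio_prodE _ _ _ p0) powRN /gamma_ratio.
have h : (p`!%:R : R) = ratio_prod 0 s p * p%:R ^+ s * (p - s)`!%:R.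
  rewrite -ratio_prodE // -(ffact_fact sp) natrM ffact_prod natr_prod; congr (_ * _).
  by apply: eq_bigr => i _; rewrite addr0 natrB // (leq_trans (ltnW (ltn_ord i))).
rewrite [X in _ / (X * _) * _ * _]h.
have f0 : 0 < p`!%:R :> R by rewrite ltr0n fact_gt0.
have : p`!%:R != 0 :> R by rewrite gt_eqF.
rewrite h !mulf_eq0 !negb_or => /andP[/andP[n1 n2] n3].
have n4 : p%:R `^ a != 0 by rewrite gt_eqF // powR_gt0.
have n5 : s`!%:R != 0 :> R by rewrite pnatr_eq0 -lt0n fact_gt0.
have n6 : Gamma (s%:R + a + 1) != 0 by rewrite gt_eqF // Gamma_gt0 // ltr_wpDl // addr_ge0.
rewrite -exprM mulnC exprM expr2.
by field; rewrite n1 n2 n3 n4 n5 n6.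
Qed.

End GammaAsymptotics.

(** * The Mehler-Heine formula *)

Section MehlerHeine.
Context {R : realType}.
Implicit Types a b : R.
Implicit Types w y z : R[i].

(** The variable w stands for (z / 2)^2, in which the series is an ordinary power series. *)
Definition bessel_term a w (k : nat) : R[i]^o :=
  (-1) ^+ k * w ^+ k / (k`!%:R * (Gamma (k%:R + a + 1))%:C).

Definition bessel_sum a w : R[i] := limn (series (bessel_term a w)).

(** Each step multiplies by k + a + 1 >= 1. This bounds 1 / Gamma (k + a + 1) uniformly in k, so
    that Bessel terms are dominated by exponential ones. *)
Lemma Gamma_le_addn a k : 0 <= a -> Gamma (a + 1) <= Gamma (k%:R + a + 1).
Proof.
move=> a0; elim: k => [|k IH]; first by rewrite add0r.
have h : 0 < k%:R + a + 1 by rewrite ltr_wpDl // addr_ge0.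
rewrite (_ : k.+1%:R + a + 1 = (k%:R + a + 1) + 1); last by rewrite -natr1; ring.
rewrite (GammaS (k%:R + a + 1)) //; apply: (le_trans IH); apply: ler_peMl; first by rewrite ltW // Gamma_gt0.
by rewrite lerDr addr_ge0.
Qed.

Lemma normc_nat k : normc (k%:R : R[i]) = k%:R.
Proof. by rewrite -(rmorph_nat (real_complex R)) normc_real ger0_norm. Qed.

Lemma normc_pos (x : R) : 0 < x -> normc x%:C = x.
Proof. by move=> x0; rewrite normc_real gtr0_norm. Qed.

Lemma inv_le_pos (u v : R) : 0 < u -> u <= v -> v^-1 <= u^-1.
Proof. by move=> u0 uv; rewrite lef_pV2 // posrE (lt_le_trans u0). Qed.

Lemma normc_bessel_term a w k : 0 <= a ->
  normc (bessel_term a w k) <= (Gamma (a + 1))^-1 * exp_coeff (normc w) k.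
Proof.
move=> a0; rewrite /bessel_term /exp_coeff /= !(Normc.normcM, Normc.normcV, normcX).
have -> : normc (-1 : R[i]) = 1 by rewrite /= oppr0 sqrrN expr1n expr0n addr0 sqrtr1.
have G1 : 0 < Gamma (a + 1) by rewrite Gamma_gt0 // ltr_wpDl.
have G2 : 0 < Gamma (k%:R + a + 1) by rewrite Gamma_gt0 // ltr_wpDl // addr_ge0.
rewrite expr1n mul1r normc_nat (normc_pos _ G2) invfM mulrA mulrC.
apply: ler_wpM2r; first by rewrite mulr_ge0 ?invr_ge0 ?ler0n ?exprn_ge0 ?normc_ge0.
by apply: inv_le_pos; [exact: G1|exact: Gamma_le_addn].
Qed.

Lemma cvg_series_exp_coeffZ (c x : R) : cvgn (series (fun k => c * exp_coeff x k)).
Proof.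
have -> : series (fun k => c * exp_coeff x k) = (fun n => c * series (exp_coeff x) n).
  by apply/funext => n; rewrite /series /= mulr_sumr.
by apply: is_cvgM; [exact: is_cvg_cst|exact: is_cvg_series_exp_coeff].
Qed.

Lemma cvg_bessel_sum a w : 0 <= a -> series (bessel_term a w) @ \oo --> (bessel_sum a w : R[i]^o).
Proof.
move=> a0; apply: (@cvg_dominated_series R _ (fun k => (Gamma (a + 1))^-1 * exp_coeff (normc w) k)).
  by move=> k; exact: normc_bessel_term.
exact: cvg_series_exp_coeffZ.
Qed.

(** Written in y = (z - 1) / 2, with (z + 1) / 2 = 1 + y, since the formula concerns points close to
    1. *)
Lemma horner_complex_jacobi a b (p : nat) z :
  horner_complex (jacobi a b p) z =
  \sum_(s < p.+1) (gbinom (p%:R + a) (p - s) * gbinom (p%:R + b) s)%:C *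
     (((z - 1) / 2) ^+ s * (1 + (z - 1) / 2) ^+ (p - s)).
Proof.
rewrite /horner_complex /jacobi rmorph_sum horner_sum; apply: eq_bigr => s _ /=.
move: (gbinom _ _ * gbinom _ _) => g.
rewrite map_polyZ hornerZ !rmorphM !rmorphXn /= hornerM !horner_exp !map_polyZ !hornerZ.
rewrite rmorphB rmorphD /= map_polyX rmorph1 !hornerE fmorphV rmorph_nat.
congr (_ * _ ^+ _ * _ ^+ _); first by rewrite mulrC.
by field.
Qed.

Lemma normc_1D_exp y (i p : nat) W : (i <= p)%N -> p%:R * normc y <= W -> normc ((1 + y) ^+ i) <= expR W.
Proof.
move=> ip h; rewrite normcX.
apply: (@le_trans _ _ (expR (normc y) ^+ i)).
  rewrite lerXn2r ?nnegrE ?normc_ge0 ?expR_ge0 //.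
  apply: (le_trans (normc_leD _ _)); rewrite Normc.normc1; exact: expR_ge1Dx.
rewrite -expRM_natl ler_expR; apply: le_trans h.
by rewrite ler_wpM2r ?normc_ge0 // ler_nat.
Qed.

(** (1 + y)^i - 1 is y times a geometric sum of at most p terms, each bounded by exp W. It tends to
    0 as soon as p y does. *)
Lemma normc_1D_exp_sub1 y (i p : nat) W : (i <= p)%N -> p%:R * normc y <= W ->
  normc ((1 + y) ^+ i - 1) <= p%:R * normc y * expR W.
Proof.
move=> ip h; rewrite subrX1 (addrC 1) addrK Normc.normcM.
rewrite mulrAC [leRHS]mulrC ler_wpM2l ?normc_ge0 //.
apply: (le_trans (normc_sum _ _ _ _)).
apply: (@le_trans _ _ (\sum_(j < i) expR W)).
  apply: ler_sum => j _; rewrite (addrC y); apply: normc_1D_exp h.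
  exact: leq_trans (ltnW (ltn_ord j)) ip.
by rewrite sumr_const card_ord -[expR W *+ i]mulr_natl ler_wpM2r ?expR_ge0 // ler_nat.
Qed.

(** The point [x t] is arbitrary apart from its rate of approach to 1, so the cosine enters only
    later and the degree may be shifted. The proof applies [tannery] to the summands [A]. *)
Lemma mehler_heine {T : Type} {F : set_system T} {FF : ProperFilter F}
    a b (p : T -> nat) (x : T -> R[i]) w :
  0 <= a -> p @ F --> \oo ->
  ((p t)%:R ^+ 2 * ((x t - 1) / 2) : R[i]^o) @[t --> F] --> (- w : R[i]^o) ->
  (((p t)%:R `^ (- a))%:C * horner_complex (jacobi a b (p t)) (x t) : R[i]^o) @[t --> F]
    --> (bessel_sum a w : R[i]^o).
Proof.
move=> a0 poo yw.
pose y t : R[i] := (x t - 1) / 2.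
pose c s (q : nat) : R := gamma_ratio a q * ratio_prod 0 s q * ratio_prod b s q / (s`!%:R * Gamma (s%:R + a + 1)).
have Gp s : 0 < Gamma (s%:R + a + 1) by rewrite Gamma_gt0 // ltr_wpDl // addr_ge0.
have fp s : 0 < s`!%:R :> R by rewrite ltr0n fact_gt0.
pose A t s : R[i]^o := (c s (p t))%:C * ((p t)%:R ^+ 2 * y t) ^+ s * (1 + y t) ^+ (p t - s).
(* Eventually |p^2 y| <= W, hence p |y| <= W / p <= W: this controls both the powers of p^2 y and
   those of 1 + y. *)
pose W := normc w + 1.
have nearp k : \forall t \near F, (k <= p t)%N by apply: (poo [set j | (k <= j)%N]); exact: nbhs_infty_ge.
have nearW : \forall t \near F, normc ((p t)%:R ^+ 2 * y t) <= W.
  move/cvg_normcP/cvgrPdist_lt/(_ _ ltr01): yw; apply: filterS => t.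
  rewrite distrC subr0 ger0_norm ?normc_ge0 // => h.
  have -> : (p t)%:R ^+ 2 * y t = ((p t)%:R ^+ 2 * y t - - w) + - w by ring.
  by apply: (le_trans (normc_leD _ _)); rewrite normcN /W addrC lerD // ltW.
have py t : (0 < p t)%N -> normc ((p t)%:R ^+ 2 * y t) <= W -> (p t)%:R * normc (y t) <= W / (p t)%:R.
  move=> p0; have pR : 0 < (p t)%:R :> R by rewrite ltr0n.
  rewrite Normc.normcM normcX normc_nat => h.
  by rewrite ler_pdivlMr // mulrAC -expr2.
have W0 : 0 <= W by rewrite addr_ge0 // normc_ge0.
have py' t : (0 < p t)%N -> normc ((p t)%:R ^+ 2 * y t) <= W -> (p t)%:R * normc (y t) <= W.
  move=> p0 /(py _ p0) /le_trans; apply.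
  by rewrite ler_pdivrMr ?ltr0n // ler_peMr // ler1n.
have cc s : c s (p t) @[t --> F] --> (s`!%:R * Gamma (s%:R + a + 1))^-1.
  have E : 1 * 1 * 1 * (s`!%:R * Gamma (s%:R + a + 1))^-1 = (s`!%:R * Gamma (s%:R + a + 1))^-1 by rewrite !mul1r.
  apply: (cvg_to_eq E); apply: cvgM; last exact: cvg_cst.
  apply: cvgM; last exact: (cvg_comp _ _ poo (ratio_prod_cvg b s)).
  by apply: cvgM; [exact: (cvg_comp _ _ poo (gamma_ratio_cvg a a0))|exact: (cvg_comp _ _ poo (ratio_prod_cvg 0 s))].
have pow1 s : ((1 + y t) ^+ (p t - s) : R[i]^o) @[t --> F] --> (1 : R[i]^o).
  apply/cvg_normcP.
  have U : W / (p t)%:R * expR W @[t --> F] --> (0 : R).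
    have E : W * 0 * expR W = 0 by rewrite mulr0 mul0r.
    apply: (cvg_to_eq E); apply: cvgM; last exact: cvg_cst.
    apply: cvgM; first exact: cvg_cst.
    exact: (cvg_comp _ _ poo cvg_harmonic0).
  apply: (squeeze_cvgr _ (cvg_cst 0) U); near=> t; rewrite normc_ge0 /=.
  have p0 : (0 < p t)%N by near: t; exact: nearp.
  have hW : normc ((p t)%:R ^+ 2 * y t) <= W by near: t; exact: nearW.
  apply: (le_trans (normc_1D_exp_sub1 _ _ _ W (leq_subr s (p t)) (py' t p0 hW))).
  by rewrite ler_wpM2r ?expR_ge0 // py.
have powX s : (((p t)%:R ^+ 2 * y t) ^+ s : R[i]^o) @[t --> F] --> ((- w) ^+ s : R[i]^o).
  elim: s => [|s IH]; first by under eq_fun do rewrite expr0; rewrite expr0; exact: cvg_cst.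
  under eq_fun do rewrite exprS; rewrite exprS; apply: cvgM; [exact: yw|exact: IH].
have AL s : A t s @[t --> F] --> bessel_term a w s.
  have E : ((s`!%:R * Gamma (s%:R + a + 1))^-1)%:C * (- w) ^+ s * 1 = bessel_term a w s.
    by rewrite /bessel_term mulr1 (exprNn w) fmorphV rmorphM rmorph_nat mulrC.
  apply: (@cvg_to_eq _ _ R[i]^o _ _ _ E); apply: cvgM; last exact: pow1.
  by apply: cvgM; [exact: cvg_real_complex|exact: powX].
(* The factor 2 eventually bounds [gamma_ratio], 1 + |b| comes from [ratio_prod b], while
   [ratio_prod 0] is at most 1. The powers of p^2 y and of 1 + y contribute W^s and exp W; with 1 /
   s! this is a multiple of an exponential series. *)
pose B := fun s => 2 * expR W / Gamma (a + 1) * exp_coeff ((1 + `|b|) * W) s.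
have AB : \forall t \near F, forall s, (s <= p t)%N -> normc (A t s) <= B s.
  near=> t => s sp.
  have p0 : (0 < p t)%N by near: t; exact: nearp.
  have hW : normc ((p t)%:R ^+ 2 * y t) <= W by near: t; exact: nearW.
  have hr : `|gamma_ratio a (p t)| <= 2.
    near: t.
    have h2 : (1 : R) < 2 by rewrite ltr1n.
    have /cvgrPdist_lt/(_ _ ltr01) := cvg_comp _ _ poo (gamma_ratio_cvg a a0).
    apply: filterS => t /= h; have := ler_normD (1 : R) (gamma_ratio a (p t) - 1).
    rewrite addrC subrK normr1 => /le_trans; apply; rewrite distrC; lra.
  rewrite /A !Normc.normcM normc_real normcX.
  have h1 := normc_1D_exp _ _ _ _ (leq_subr s (p t)) (py' t p0 hW).
  have h2 : normc ((p t)%:R ^+ 2 * y t) ^+ s <= W ^+ s by rewrite lerXn2r ?nnegrE ?normc_ge0.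
  have h3 : `|c s (p t)| <= 2 * (1 + `|b|) ^+ s / (s`!%:R * Gamma (a + 1)).
    rewrite /c normrM normfV (gtr0_norm (mulr_gt0 (fp s) (Gp s))).
    apply: ler_pM; [exact: normr_ge0|by rewrite invr_ge0 ltW // mulr_gt0| |].
      rewrite 2!normrM; apply: ler_pM; rewrite ?mulr_ge0 //; last exact: ratio_prod_le.
      rewrite -[leRHS]mulr1; apply: ler_pM => //.
      by have := @ratio_prod_le R 0 s (p t) p0 sp; rewrite normr0 addr0 expr1n.
    have G1 : 0 < Gamma (a + 1) by rewrite Gamma_gt0 // ltr_wpDl.
    apply: inv_le_pos; first exact: mulr_gt0.
    by apply: ler_wpM2l; [exact: ler0n|exact: Gamma_le_addn].
  have -> : B s = 2 * (1 + `|b|) ^+ s / (s`!%:R * Gamma (a + 1)) * W ^+ s * expR W.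
    by rewrite /B /exp_coeff /= exprMn invfM; ring.
  apply: ler_pM => //; rewrite ?mulr_ge0 ?exprn_ge0 ?normc_ge0 //.
  by apply: ler_pM => //; rewrite ?exprn_ge0 ?normc_ge0.
have := tannery p A _ B _ poo (cvg_series_exp_coeffZ _ _) AL AB (cvg_bessel_sum a w a0).
move=> /(_ FF) G.
have E : \forall t \near F, (\sum_(s < (p t).+1) A t s : R[i]^o) =
    ((p t)%:R `^ (- a))%:C * horner_complex (jacobi a b (p t)) (x t) :> R[i]^o; last first.
  have H := near_eq_cvg E; exact: cvg_trans (H _) G.
apply: filterS (nearp 1%N) => t p0.
rewrite horner_complex_jacobi mulr_sumr; apply: eq_bigr => s _.
have sp : (s <= p t)%N by rewrite -ltnS.
rewrite mulrA -rmorphM (jacobi_coef a b (p t) s a0 p0 sp) -/(c s (p t)) /A -/(y t).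
move: (c s (p t)) => g.
by rewrite rmorphM !rmorphXn rmorph_nat exprMn !mulrA.
Unshelve. all: by end_near.
Qed.
End MehlerHeine.

(** * The complex cosine *)

Section ComplexCosine.
Context {R : realType}.
Implicit Types z w : R[i].

Section cvg.
Context {T : Type} {F : set_system T} {FF : Filter F}.

(** The derivative at 0 in the form needed along a filter: the increment of f is its difference
    quotient times v, and N v converges. *)
Lemma cvg_scaled_increment (f : R -> R) (d : R) (N v : T -> R) (V : R) :
  is_derive (0 : R) (1 : R) f d -> v @ F --> (0 : R) -> N t * v t @[t --> F] --> V ->
  N t * (f (v t) - f 0) @[t --> F] --> d * V.
Proof.
move=> [df fd] v0 NV.
(* The quotient is extended by its limit d at 0, because [v t] may vanish. *)
pose psi h := if h == 0 then d else h^-1 * (f h - f 0).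
have psid : psi @ (0 : R) --> d.
  have p0 : psi 0 = d by rewrite /psi eqxx.
  rewrite -{1}p0; apply/continuous_withinNx; rewrite p0 -fd.
  have : h^-1 *: (f (h *: (1 : R) + 0) - f 0) @[h --> (0 : R)^'] --> 'D_1 f 0 := df.
  apply: cvg_trans; apply: near_eq_cvg; near=> h.
  have h0 : h != 0 by near: h; exact: nbhs_dnbhs_neq.
  by rewrite /psi (negbTE h0) addr0 [h *: _]mulr1.
have -> : (fun t => N t * (f (v t) - f 0)) = (fun t => psi (v t) * (N t * v t)).
  apply/funext => t; rewrite /psi; case: eqP => [->|/eqP v1]; first by rewrite subrr !mulr0.
  by field.
by apply: cvgM => //; exact: (cvg_comp _ _ v0 psid).
Unshelve. all: by end_near.
Qed.

(** Expresses that the complex exponential has derivative 1 at 0. It is deduced from the real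
    derivatives 1, 0 and 1 of exp, cos and sin at 0. *)
Lemma cvg_scaled_expC (N : T -> R) (u : T -> R[i]) (l : R[i]) :
  (u : T -> R[i]^o) @ F --> (0 : R[i]^o) -> ((N t)%:C * u t : R[i]^o) @[t --> F] --> (l : R[i]^o) ->
  ((N t)%:C * (expC (u t) - 1) : R[i]^o) @[t --> F] --> (l : R[i]^o).
Proof.
move=> u0 Nu.
have Re0 : complex.Re (u t) @[t --> F] --> (0 : R) by exact: (cvg_Re _ _ u0).
have Im0 : complex.Im (u t) @[t --> F] --> (0 : R) by exact: (cvg_Im _ _ u0).
have ReN : N t * complex.Re (u t) @[t --> F] --> complex.Re l.
  have -> : (fun t => N t * complex.Re (u t)) = (fun t => complex.Re ((N t)%:C * u t)); last exact: (cvg_Re _ _ Nu).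
  by apply/funext => t; case: (u t) => a b /=; rewrite mul0r subr0.
have ImN : N t * complex.Im (u t) @[t --> F] --> complex.Im l.
  have -> : (fun t => N t * complex.Im (u t)) = (fun t => complex.Im ((N t)%:C * u t)); last exact: (cvg_Im _ _ Nu).
  by apply/funext => t; case: (u t) => a b /=; rewrite mul0r addr0.
have e1 : N t * (expR (complex.Re (u t)) - 1) @[t --> F] --> complex.Re l.
  have H : is_derive (0 : R) (1 : R) expR 1 by apply: is_derive_eq; exact: expR0.
  have := cvg_scaled_increment _ _ _ _ _ H Re0 ReN; by rewrite expR0 mul1r.
have c1 : N t * (cos (complex.Im (u t)) - 1) @[t --> F] --> (0 : R).
  have H : is_derive (0 : R) (1 : R) cos 0 by apply: is_derive_eq; rewrite sin0 oppr0.
  have := cvg_scaled_increment _ _ _ _ _ H Im0 ImN; by rewrite cos0 mul0r.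
have s1 : N t * sin (complex.Im (u t)) @[t --> F] --> complex.Im l.
  have H : is_derive (0 : R) (1 : R) sin 1 by apply: is_derive_eq; rewrite cos0.
  have := cvg_scaled_increment _ _ _ _ _ H Im0 ImN; rewrite sin0 mul1r.
  by under eq_fun do rewrite subr0.
have ec : expR (complex.Re (u t)) @[t --> F] --> (1 : R).
  by rewrite -[X in _ --> X]expR0; apply: continuous_cvg; [exact: continuous_expR|].
(* The real part is split as e^a cos b - 1 = (cos b - 1) e^a + (e^a - 1), the imaginary part being
   e^a sin b. *)
have -> : (fun t => (N t)%:C * (expC (u t) - 1) : R[i]^o) =
  (fun t => (N t * (cos (complex.Im (u t)) - 1) * expR (complex.Re (u t)) + N t * (expR (complex.Re (u t)) - 1))
     +i* (N t * sin (complex.Im (u t)) * expR (complex.Re (u t)))).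
  apply/funext => t; case: (u t) => a b; rewrite /expC /=; simpc; congr (_ +i* _); ring.
have -> : l = (0 * 1 + complex.Re l) +i* (complex.Im l * 1).
  by case: l {Nu ReN ImN e1 s1} => a b /=; rewrite mul0r add0r mulr1.
by apply: cvg_complex; [apply: cvgD => //; exact: cvgM|exact: cvgM].
Qed.

End cvg.

Lemma expC_add z w : expC (z + w) = expC z * expC w.
Proof.
case: z w => a b [c d]; rewrite /expC /= expRD cosD sinD; simpc; congr (_ +i* _); ring.
Qed.

Lemma expC0 : expC (0 : R[i]) = 1.
Proof. by rewrite /expC /= expR0 cos0 sin0 mul1r. Qed.

(** This is cos z - 1 = - 2 sin^2 (z / 2). Being a square, it yields the second-order limit from
    first-order information on the exponential. *)
Lemma cosC_sub1 z : cosC z - 1 = (expC ('i * z / 2) - expC (- ('i * z / 2))) ^+ 2 / 2.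
Proof.
have e1 : expC ('i * z) = expC ('i * z / 2) ^+ 2.
  by rewrite expr2 -expC_add; congr expC; field.
have e2 : expC (- ('i * z)) = expC (- ('i * z / 2)) ^+ 2.
  by rewrite expr2 -expC_add; congr expC; field.
have e3 : expC ('i * z / 2) * expC (- ('i * z / 2)) = 1 by rewrite -expC_add subrr expC0.
by rewrite /cosC e1 e2 sqrrB e3; field.
Qed.

Lemma cvg_scaled_cosC {T : Type} {F : set_system T} {FF : Filter F} (n : T -> nat) (z : T -> R[i]) (z0 : R[i]) :
  n @ F --> \oo -> (z : T -> R[i]^o) @ F --> (z0 : R[i]^o) ->
  ((n t)%:R ^+ 2 * ((cosC (z t / (n t)%:R) - 1) / 2) : R[i]^o) @[t --> F] --> (- (z0 / 2) ^+ 2 : R[i]^o).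
Proof.
move=> noo zz.
have V0 : (((n t)%:R^-1)%:C : R[i]^o) @[t --> F] --> (0 : R[i]^o).
  exact: (cvg_real_complex _ _ (cvg_comp _ _ noo cvg_harmonic0)).
have near0 : \forall t \near F, (0 < n t)%N by apply: (noo [set j | (0 < j)%N]); exact: nbhs_infty_gt.
have key (c : R[i]) : (((n t)%:R)%:C * (expC (c * z t * ((n t)%:R^-1)%:C) - 1) : R[i]^o) @[t --> F] --> (c * z0 : R[i]^o).
  have cz : (c * z t : R[i]^o) @[t --> F] --> (c * z0 : R[i]^o).
    by apply: cvgM; [exact: cvg_cst|exact: zz].
  apply: cvg_scaled_expC.
    have E : (c * z0 * 0 : R[i]) = 0 by rewrite mulr0.
    apply: (@cvg_to_eq _ _ R[i]^o _ _ _ E); apply: cvgM; [exact: cz|exact: V0].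
  have E : \forall t \near F, (c * z t : R[i]^o) = ((n t)%:R)%:C * (c * z t * ((n t)%:R^-1)%:C).
    apply: filterS near0 => t n0; rewrite [RHS]mulrC -[RHS]mulrA -rmorphM mulVf ?mulr1 //.
    by rewrite pnatr_eq0 -lt0n.
  have H := near_eq_cvg E; exact: cvg_trans (H _) cz.
(* The difference of the two scaled increments tends to i z0; its square divided by 4 tends to - (z0
   / 2)^2. *)
have k1 := key ('i / 2); have k2 := key (- ('i / 2)).
have E : ('i / 2 * z0 - (- ('i / 2)) * z0) * ('i / 2 * z0 - (- ('i / 2)) * z0) * (2^-1 * 2^-1) = - (z0 / 2) ^+ 2.
  have := @sqr_i R => i2.
  transitivity ('i ^+ 2 * (z0 / 2) ^+ 2); first by field.
  by rewrite i2 mulN1r.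
apply: (@cvg_to_eq _ _ R[i]^o _ _ _ E).
have -> : (fun t => (n t)%:R ^+ 2 * ((cosC (z t / (n t)%:R) - 1) / 2) : R[i]^o) =
  (fun t => let D := ((n t)%:R)%:C * (expC ('i / 2 * z t * ((n t)%:R^-1)%:C) - 1)
          - ((n t)%:R)%:C * (expC (- ('i / 2) * z t * ((n t)%:R^-1)%:C) - 1) in D * D * (2^-1 * 2^-1)).
  apply/funext => t; rewrite cosC_sub1 fmorphV !rmorph_nat.
  have -> : 'i / 2 * z t * (n t)%:R^-1 = 'i * (z t / (n t)%:R) / 2 by ring.
  have -> : - ('i / 2) * z t * (n t)%:R^-1 = - ('i * (z t / (n t)%:R) / 2) by ring.
  by move: (expC _) (expC _) => e1 e2 /=; ring.
have kD := cvgB k1 k2.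
by apply: cvgM; [apply: cvgM; exact: kD|exact: cvg_cst].
Qed.

End ComplexCosine.

(** * Exceptional Jacobi polynomials *)

Section ExceptionalJacobi.
Context {R : realType}.
Implicit Types z w : R[i].

Lemma real_complexM (x y : R) : (x * y)%:C = x%:C * y%:C :> R[i].
Proof. exact: rmorphM. Qed.

(** Over the common factor (- w)^(k+1) / ((k+1)! Gamma (k + a + 3)) the identity reads k + a + 2 =
    (a + 1) + (k + 1). *)
Lemma bessel_term_rec a w k : -1 < a ->
  bessel_term a w k.+1 = (a + 1)%:C * bessel_term (a + 1) w k.+1 - w * bessel_term (a + 2) w k.
Proof.
move=> a1; rewrite /bessel_term.
have g0 : 0 < k%:R + a + 2 :> R.
  by rewrite -addrA ltr_wpDl // -[2]/(1 + 1) addrA ltr_wpDr // -ltrBlDr sub0r.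
have -> : k.+1%:R + a + 1 = k%:R + a + 2 by rewrite -natr1; ring.
have -> : k.+1%:R + (a + 1) + 1 = k%:R + a + 2 + 1 by rewrite -natr1; ring.
have -> : k%:R + (a + 2) + 1 = k%:R + a + 2 + 1 by ring.
rewrite (GammaS (k%:R + a + 2)) //.
have := Gamma_gt0 _ g0; move: (Gamma _) => G /gt_eqF G0.
rewrite factS natrM !exprS rmorphM.
have h1 : G%:C != 0 :> R[i] by rewrite eq_complex /= G0.
have h2 : (k%:R + a + 2)%:C != 0 :> R[i] by rewrite eq_complex /= (gt_eqF g0).
have h3 : k.+1%:R != 0 :> R[i] by rewrite pnatr_eq0.
have h4 : k`!%:R != 0 :> R[i] by rewrite pnatr_eq0 -lt0n fact_gt0.
rewrite !rmorphD !rmorph_nat rmorph1 -natr1 in h2 h3 *.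
by field; rewrite ?h1 ?h2 ?h3 ?h4.
Qed.

Lemma bessel_term0 a w : bessel_term a w 0 = ((Gamma (a + 1))%:C)^-1.
Proof. by rewrite /bessel_term !expr0 fact0 add0r !mul1r. Qed.

(** The recurrence is summed with the last series one term shorter. For -1 < a < 0, outside the
    range of [cvg_bessel_sum], this also yields convergence, as both parameters on the right are
    positive. *)
Lemma bessel_sum_rec a w : -1 < a ->
  bessel_sum a w = (a + 1)%:C * bessel_sum (a + 1) w - w * bessel_sum (a + 2) w.
Proof.
move=> a1.
have a0 : 0 < a + 1 by rewrite -ltrBlDr sub0r.
pose S b n : R[i] := \sum_(0 <= k < n) (bessel_term b w k : R[i]).
have SS b n : S b n.+1 = S b n + bessel_term b w n by rewrite /S big_nat_recr.
have S0 b : S b 0 = 0 by rewrite /S big_geq.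
have E n : S a n.+1 = (a + 1)%:C * S (a + 1) n.+1 - w * S (a + 2) n.
  elim: n => [|n IH].
    have S1 b : S b 1 = ((Gamma (b + 1))%:C)^-1 by rewrite (SS b) S0 bessel_term0; exact: add0r.
    rewrite (S1 a) (S1 (a + 1)) S0 (GammaS (a + 1) a0); move: (Gamma (a + 1)) => G.
    rewrite mulr0 subr0 rmorphM invfM mulrA mulfV ?mul1r //.
    by rewrite eq_complex /= (gt_eqF a0).
  rewrite (SS a n.+1) (SS (a + 1) n.+1) (SS (a + 2) n) IH (bessel_term_rec a w n a1).
  move: (S _ _) (S _ _) (bessel_term _ _ _) (bessel_term _ _ _) ((a + 1)%:C) => s1 s2 b1 b2 c; ring.
have L1 := cvg_bessel_sum (a + 1) w _.
have L2 := cvg_bessel_sum (a + 2) w _.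
rewrite /bessel_sum; apply: (@cvg_lim R[i]^o); first exact: norm_hausdorff.
rewrite -cvg_shiftS.
have -> : [sequence series (bessel_term a w) n.+1]_n =
  (fun n => (a + 1)%:C * S (a + 1) n.+1 - w * S (a + 2) n : R[i]^o) by apply/funext => n; exact: E.
apply: cvgB; apply: cvgM.
- exact: cvg_cst.
- by rewrite (cvg_shiftS (series (bessel_term (a + 1) w))); apply: L1; lra.
- exact: cvg_cst.
- by apply: L2; lra.
Qed.

Lemma bessel_entireE a z : bessel_entire a z = bessel_sum a ((z / 2) ^+ 2).
Proof.
rewrite /bessel_sum (_ : bessel_term a _ = fun k => (-1) ^+ k * (z / 2) ^+ (2 * k)
  / (k`!%:R * (Gamma (k%:R + a + 1))%:C) : R[i]^o) //.
by apply/funext => k; rewrite /bessel_term exprM.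
Qed.

(** Both sides equal x (x - 1) ... (x - m) / m!. *)
Lemma gbinom_shift (x : R) m :
  x * gbinom (x - 1) m = gbinom x m * (x - m%:R).
Proof.
rewrite /gbinom mulrA [RHS]mulrAC; congr (_ / _).
transitivity (\prod_(i < m.+1) (x - i%:R)); last by rewrite big_ord_recr.
rewrite big_ord_recl subr0; congr (_ * _); apply: eq_bigr => i _.
by rewrite lift0 -natr1; ring.
Qed.

(** Joint convergence at z0 gives a neighbourhood of z0 and a range of n on which f n z stays near g
    z0; compactness, in near-covering form, makes the range common to all of K. *)
Lemma uniform_of_joint_cvg (f : nat -> R[i]^o -> R[i]^o) (g : R[i]^o -> R[i]^o) (K : set R[i]^o) :
  compact K ->
  (forall z0 : R[i]^o, f t.2 t.1 @[t --> filter_prod (nbhs z0) \oo] --> g z0) ->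
  {uniform K, f @ \oo --> g}.
Proof.
move=> cK fg Q /uniform_nbhs [E [entE EQ]].
apply: (filterS EQ).
move: entE; rewrite -entourage_ballE => -[e /= e0 eE].
have e3 : 0 < e / 3 by rewrite divr_gt0.
have fgz (z : R[i]^o) : f n z @[n --> \oo] --> g z.
  move=> A /(fg z) [[/= B C] [Bz Cn] BC] /=.
  by apply: filterS Cn => n Cn; apply: (BC (z, n)); split => //=; exact: nbhs_singleton.
have := (compact_near_coveringP K).1 cK nat \oo (fun n z => ball (g z) e (f n z)) _.
move=> /(_ _ _) H.
have {}H : \forall n \near \oo, K `<=` [set z | ball (g z) e (f n z)].
  apply: H => z0 _; have /cvgrPdist_lt/(_ _ e3) [[/= B C] [Bz Cn] BC] := fg z0.
  exists (B, C) => //= -[z n] /= [Bz' Cn']; rewrite -ball_normE /=.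
  have h1 : `|g z0 - f n z| < e / 3 by apply: (BC (z, n)).
  have /cvgrPdist_lt/(_ _ e3) fz := fgz z.
  (* No continuity of g is assumed: g z is compared with g z0 through f k z, with k in the same
     range and large enough for pointwise convergence at z. *)
  have [k [Ck fk]] := filter_ex (filterI Cn fz).
  have h2 : `|g z0 - f k z| < e / 3 by apply: (BC (z, k)).
  have -> : g z - f n z = (g z - f k z) + (f k z - g z0) + (g z0 - f n z) by ring.
  apply: (le_lt_trans (ler_normD _ _)).
  have -> : e = e / 3 + e / 3 + e / 3 by field.
  apply: ltrD => //; apply: (le_lt_trans (ler_normD _ _)); apply: ltrD => //.
  by rewrite distrC.
by apply: filterS H => n Hn z Kz; apply: eE; exact: Hn.
Qed.

Lemma horner_complexD (p q : {poly R}) z : horner_complex (p + q) z = horner_complex p z + horner_complex q z.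
Proof. by rewrite /horner_complex rmorphD hornerD. Qed.
Lemma horner_complexM (p q : {poly R}) z : horner_complex (p * q) z = horner_complex p z * horner_complex q z.
Proof. by rewrite /horner_complex rmorphM hornerM. Qed.
Lemma horner_complexZ (c : R) (p : {poly R}) z : horner_complex (c *: p) z = c%:C * horner_complex p z.
Proof. by rewrite /horner_complex map_polyZ hornerZ. Qed.
Lemma horner_complexXsub1 z : horner_complex ('X - 1 : {poly R}) z = z - 1.
Proof. by rewrite /horner_complex rmorphB /= map_polyX rmorph1 !hornerE. Qed.

Lemma horner_complex_jacobi1 (a b : R) (p : nat) : horner_complex (jacobi a b p) 1 = (gbinom (p%:R + a) p)%:C.
Proof.
rewrite horner_complex_jacobi subrr mul0r addr0 big_ord_recl big1 ?addr0.
  by rewrite subn0 expr0 expr1n !mulr1 /gbinom big_ord0 fact0 divr1 mulr1.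
by move=> i _; rewrite expr0n /= mul0r mulr0.
Qed.

Section lim.
Context {T : Type} {F : set_system T} {FF : ProperFilter F}.

Lemma cvg_horner_complex (p : {poly R}) (x : T -> R[i]) (x0 : R[i]) :
  (x : T -> R[i]^o) @ F --> (x0 : R[i]^o) ->
  (horner_complex p (x t) : R[i]^o) @[t --> F] --> (horner_complex p x0 : R[i]^o).
Proof.
move=> xx; rewrite /horner_complex; elim/poly_ind: (map_poly _ p) => [|q c IH].
  by under eq_fun do rewrite horner0; rewrite horner0; exact: cvg_cst.
under eq_fun do rewrite hornerMXaddC.
rewrite hornerMXaddC; apply: cvgD; last exact: cvg_cst.
by apply: cvgM; [exact: IH|exact: xx].
Qed.

(** Normalises by n rather than by the degree n - k. Since (n - k) / n tends to 1, so does its power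
    a, and the rate hypothesis transfers to n - k. *)
Lemma mehler_heine_shift (a b : R) (k : nat) (n : T -> nat) (x : T -> R[i]) w :
  0 <= a -> n @ F --> \oo ->
  ((n t)%:R ^+ 2 * ((x t - 1) / 2) : R[i]^o) @[t --> F] --> (- w : R[i]^o) ->
  (((n t)%:R `^ (- a))%:C * horner_complex (jacobi a b (n t - k)%N) (x t) : R[i]^o) @[t --> F]
    --> (bessel_sum a w : R[i]^o).
Proof.
move=> a0 noo nx.
have poo : (fun t => n t - k)%N @ F --> \oo.
  move=> A [N _ NA].
  have NF : \forall t \near F, (N + k <= n t)%N.
    by apply: (noo [set j | (N + k <= j)%N]); exact: nbhs_infty_ge.
  by apply: filterS NF => t h; apply: NA => /=; rewrite leq_subRL ?(leq_trans (leq_addl _ _) h) // addnC.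
have near0 : \forall t \near F, (k < n t)%N by apply: (noo [set j | (k < j)%N]); exact: nbhs_infty_gt.
have r1 : (n t - k)%:R / (n t)%:R @[t --> F] --> (1 : R).
  have U : 1 - k%:R * (n t)%:R^-1 @[t --> F] --> (1 : R).
    have E : 1 - k%:R * 0 = 1 :> R by rewrite mulr0 subr0.
    apply: (cvg_to_eq E); apply: cvgB; first exact: cvg_cst.
    by apply: cvgM; [exact: cvg_cst|exact: (cvg_comp _ _ noo cvg_harmonic0)].
  have E : \forall t \near F, 1 - k%:R * (n t)%:R^-1 = (n t - k)%:R / (n t)%:R :> R.
    apply: filterS near0 => t nk; rewrite natrB ?(ltnW nk) // mulrBl divff //.
    by rewrite pnatr_eq0 -lt0n (leq_ltn_trans _ nk).
  have H := near_eq_cvg E; exact: cvg_trans (H _) U.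
have px : ((n t - k)%:R ^+ 2 * ((x t - 1) / 2) : R[i]^o) @[t --> F] --> (- w : R[i]^o).
  have E : (1 : R)%:C * (1 : R)%:C * - w = - w by rewrite !mul1r.
  have U : ((((n t - k)%:R / (n t)%:R)%:C * ((n t - k)%:R / (n t)%:R)%:C * ((n t)%:R ^+ 2 * ((x t - 1) / 2))) : R[i]^o)
     @[t --> F] --> (- w : R[i]^o).
    apply: (@cvg_to_eq _ _ R[i]^o _ _ _ E); apply: cvgM; last exact: nx.
    by apply: cvgM; apply: cvg_real_complex; exact: r1.
  have E' : \forall t \near F, (((n t - k)%:R / (n t)%:R)%:C * ((n t - k)%:R / (n t)%:R)%:C * ((n t)%:R ^+ 2 * ((x t - 1) / 2)) : R[i]^o)
      = (n t - k)%:R ^+ 2 * ((x t - 1) / 2).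
    apply: filterS near0 => t nk; rewrite rmorphM fmorphV !rmorph_nat; field.
    by rewrite pnatr_eq0 -lt0n (leq_ltn_trans _ nk).
  have H := near_eq_cvg E'; exact: cvg_trans (H _) U.
have MH := mehler_heine a b (fun t => n t - k)%N x w a0 poo px.
have U : (((((n t - k)%:R / (n t)%:R) `^ a)%:C * (((n t - k)%:R `^ (- a))%:C * horner_complex (jacobi a b (n t - k)%N) (x t))) : R[i]^o)
     @[t --> F] --> (bessel_sum a w : R[i]^o).
  have E : (1 `^ a : R)%:C * bessel_sum a w = bessel_sum a w by rewrite powR1 mul1r.
  apply: (@cvg_to_eq _ _ R[i]^o _ _ _ E); apply: cvgM; last exact: MH.
  apply: cvg_real_complex.
  exact: (cvg_comp _ _ r1 (continuous_powR a 1 ltr01)).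
have E' : \forall t \near F, ((((n t - k)%:R / (n t)%:R) `^ a)%:C * (((n t - k)%:R `^ (- a))%:C * horner_complex (jacobi a b (n t - k)%N) (x t)) : R[i]^o)
   = ((n t)%:R `^ (- a))%:C * horner_complex (jacobi a b (n t - k)%N) (x t).
  apply: filterS near0 => t nk; rewrite mulrA -rmorphM; congr (_%:C * _).
  have pR : 0 < (n t - k)%:R :> R by rewrite ltr0n subn_gt0.
  have nR : 0 < (n t)%:R :> R by rewrite ltr0n (leq_ltn_trans _ nk).
  rewrite powRM ?invr_ge0 ?ler0n // !powRN.
  have -> : (n t)%:R^-1 `^ a = ((n t)%:R `^ a)^-1 :> R.
    by rewrite -powR_inv1 ?ler0n // -powRrM mulN1r powRN.
  by rewrite mulrAC mulfV ?mul1r // gt_eqF // powR_gt0.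
have H := near_eq_cvg E'; exact: cvg_trans (H _) U.
Qed.

(** In the first summand n^(- alpha) = n^2 n^(- alpha - 2), and n^2 goes to (x - 1) / 2, giving - w.
    In the second the denominator alpha + 1 + j supplies the missing 1/n. Every factor then has a
    limit. *)
Lemma cvg_xjacobi (m : nat) (alpha beta : R) (n : T -> nat) (z : T -> R[i]) (z0 : R[i]) :
  -1 < alpha -> n @ F --> \oo -> (z : T -> R[i]^o) @ F --> (z0 : R[i]^o) ->
  (((n t)%:R `^ (- alpha))%:C * horner_complex (xjacobi alpha beta m (n t)) (cosC (z t / (n t)%:R)) : R[i]^o)
    @[t --> F] -->
  (((-1) ^+ m * gbinom (m%:R - 1 - alpha) m)%:C * bessel_entire alpha z0 : R[i]^o).
Proof.
move=> al noo zz.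
pose x t := cosC (z t / (n t)%:R); pose w := (z0 / 2) ^+ 2.
have nx : ((n t)%:R ^+ 2 * ((x t - 1) / 2) : R[i]^o) @[t --> F] --> (- w : R[i]^o).
  exact: cvg_scaled_cosC.
have near0 : \forall t \near F, (m.+1 < n t)%N by apply: (noo [set j | (m.+1 < j)%N]); exact: nbhs_infty_gt.
have ninv : (n t)%:R^-1 @[t --> F] --> (0 : R) by exact: (cvg_comp _ _ noo cvg_harmonic0).
have x1 : (x : T -> R[i]^o) @ F --> (1 : R[i]^o).
  have E : 1 + 2 * (((0 : R)%:C * (0 : R)%:C) * - w) = 1 by rewrite !mul0r mulr0 addr0.
  have U : (1 + 2 * ((((n t)%:R^-1)%:C * ((n t)%:R^-1)%:C) * ((n t)%:R ^+ 2 * ((x t - 1) / 2))) : R[i]^o) @[t --> F] --> (1 : R[i]^o).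
    apply: (@cvg_to_eq _ _ R[i]^o _ _ _ E); apply: cvgD; first exact: cvg_cst.
    apply: cvgM; first exact: cvg_cst.
    apply: cvgM; last exact: nx.
    by apply: cvgM; apply: cvg_real_complex; exact: ninv.
  have E' : \forall t \near F, (1 + 2 * ((((n t)%:R^-1)%:C * ((n t)%:R^-1)%:C) * ((n t)%:R ^+ 2 * ((x t - 1) / 2))) : R[i]^o) = x t.
    apply: filterS near0 => t nk; rewrite fmorphV !rmorph_nat; field.
    by rewrite pnatr_eq0 -lt0n (leq_ltn_trans _ nk).
  have H := near_eq_cvg E'; exact: cvg_trans (H _) U.
have MH1 := mehler_heine_shift (alpha + 2) beta m.+1 n x w _ noo nx.
have MH2 := mehler_heine_shift (alpha + 1) (beta - 1) m n x w _ noo nx.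
have J1 := cvg_horner_complex (jacobi (- alpha - 1) (beta - 1) m) x 1 x1.
have J2 := cvg_horner_complex (jacobi (- alpha - 2) beta m) x 1 x1.
rewrite horner_complex_jacobi1 in J1; rewrite horner_complex_jacobi1 in J2.
have ratio c : (c + (n t)%:R) / (n t)%:R @[t --> F] --> (1 : R).
  have U : c * (n t)%:R^-1 + 1 @[t --> F] --> (1 : R).
    have E : c * 0 + 1 = 1 by rewrite mulr0 add0r.
    by apply: (cvg_to_eq E); apply: cvgD; [apply: cvgM => //; exact: cvg_cst|exact: cvg_cst].
  have E' : \forall t \near F, c * (n t)%:R^-1 + 1 = (c + (n t)%:R) / (n t)%:R.
    apply: filterS near0 => t nk; rewrite mulrDl divff //.
    by rewrite pnatr_eq0 -lt0n (leq_ltn_trans _ nk).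
  have H := near_eq_cvg E'; exact: cvg_trans (H _) U.
(* With j = n - m, the numbers 1 + alpha + beta + j and alpha + 1 + j become c1 + n and c2 + n; c2
   is also the coefficient alpha + 1 - m of the second summand. *)
pose c1 := 1 + alpha + beta - m%:R; pose c2 := alpha + 1 - m%:R.
have Q t : (m.+1 < n t)%N -> 0 < c2 + (n t)%:R.
  move=> nk; rewrite /c2 -addrA ltr_wpDr //; first by rewrite addrC subr_ge0 ler_nat ltnW // ltnW.
  by rewrite -ltrBlDr sub0r.
have r2 : (n t)%:R / (c2 + (n t)%:R) @[t --> F] --> (1 : R).
  have H : ((c2 + (n t)%:R) / (n t)%:R)^-1 @[t --> F] --> (1^-1 : R) by apply: cvgV; [exact: oner_neq0|exact: ratio].
  by rewrite invr1 in H; under eq_fun do rewrite -invf_div.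
pose G t : R[i]^o := ((-1) ^+ m)%:C *
   (((c1 + (n t)%:R) / (n t)%:R)%:C * ((n t)%:R / (c2 + (n t)%:R))%:C * ((n t)%:R ^+ 2 * ((x t - 1) / 2))
       * horner_complex (jacobi (- alpha - 1) (beta - 1) m) (x t)
       * (((n t)%:R `^ (- (alpha + 2)))%:C * horner_complex (jacobi (alpha + 2) beta (n t - m.+1)%N) (x t))
    + c2%:C * ((n t)%:R / (c2 + (n t)%:R))%:C * horner_complex (jacobi (- alpha - 2) beta m) (x t)
       * (((n t)%:R `^ (- (alpha + 1)))%:C * horner_complex (jacobi (alpha + 1) (beta - 1) (n t - m)%N) (x t))).
have U : G t @[t --> F] -->
  (((-1) ^+ m * gbinom (m%:R - 1 - alpha) m)%:C * bessel_entire alpha z0 : R[i]^o).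
  have E : ((-1) ^+ m)%:C * ((1 : R)%:C * (1 : R)%:C * - w * (gbinom (m%:R + (- alpha - 1)) m)%:C * bessel_sum (alpha + 2) w
     + c2%:C * (1 : R)%:C * (gbinom (m%:R + (- alpha - 2)) m)%:C * bessel_sum (alpha + 1) w) =
     ((-1) ^+ m * gbinom (m%:R - 1 - alpha) m)%:C * bessel_entire alpha z0.
    rewrite bessel_entireE (bessel_sum_rec alpha) // -[(z0 / 2) ^+ 2]/w; move: (w) => v.
    set g := gbinom (m%:R - 1 - alpha) m.
    have -> : gbinom (m%:R + (- alpha - 1)) m = g by rewrite /g; congr gbinom; ring.
    (* With x = m - 1 - alpha one has c2 = - x and x - m = - (alpha + 1), so [gbinom_shift] gives
       both summands the common factor g and the coefficients of the Bessel recurrence. *)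
    have h2 : c2 * gbinom (m%:R + (- alpha - 2)) m = g * (alpha + 1).
      have -> : m%:R + (- alpha - 2) = m%:R - 1 - alpha - 1 by ring.
      have := gbinom_shift (m%:R - 1 - alpha) m; rewrite -/g => h.
      have -> : c2 = - (m%:R - 1 - alpha) by rewrite /c2; ring.
      by rewrite mulNr h; ring.
    have -> : c2%:C * (1 : R)%:C * (gbinom (m%:R + (- alpha - 2)) m)%:C = g%:C * (alpha + 1)%:C.
      by rewrite mulr1 -!rmorphM h2.
    rewrite (real_complexM ((-1) ^+ m) g).
    move: (bessel_sum (alpha + 2) v) (bessel_sum (alpha + 1) v) => s2 s1.
    move: (g%:C) ((alpha + 1)%:C) (((-1) ^+ m)%:C) => g' a1 e.
    by rewrite rmorph1; ring.
  apply: (@cvg_to_eq _ _ R[i]^o _ _ _ E); apply: cvgM; first exact: cvg_cst.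
  apply: cvgD; apply: cvgM.
  - apply: cvgM; last exact: J1.
    apply: cvgM; last exact: nx.
    by apply: cvgM; apply: cvg_real_complex; [exact: ratio|exact: r2].
  - by apply: MH1; lra.
  - apply: cvgM; last exact: J2.
    by apply: cvgM; [exact: cvg_cst|apply: cvg_real_complex; exact: r2].
  - by apply: MH2; lra.
have E' : \forall t \near F, G t = ((n t)%:R `^ (- alpha))%:C * horner_complex (xjacobi alpha beta m (n t)) (x t) :> R[i]^o.
  apply: filterS near0 => t nk; rewrite /G /xjacobi.
  have mn : (m <= n t)%N by rewrite ltnW // ltnW.
  have nR : 0 < (n t)%:R :> R by rewrite ltr0n (leq_ltn_trans _ nk).
  (* Since n > m + 1, the integer index j - 1 is a natural number and the convention for negative
     indices does not intervene. *)
  have -> : ((n t - m)%:Z - 1 : int) = (n t - m.+1)%N :> int.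
    by rewrite subnS -predn_int // subn_gt0 ltnW.
  rewrite horner_complexZ horner_complexD !horner_complexZ !horner_complexM horner_complexXsub1.
  move: (horner_complex _ (x t)) (horner_complex _ (x t)) (horner_complex _ (x t)) (horner_complex _ (x t)) => h1 h2 h3 h4.
  have -> : (n t)%:R `^ (- (alpha + 2)) = (n t)%:R `^ (- alpha) / (n t)%:R ^+ 2 :> R.
    rewrite opprD powRD ?(gt_eqF nR) ?implybT //; congr (_ * _).
    by rewrite -[2]/(2%:R) powR_invn ?ler0n.
  have -> : (n t)%:R `^ (- (alpha + 1)) = (n t)%:R `^ (- alpha) / (n t)%:R :> R.
    by rewrite opprD powRD ?(gt_eqF nR) ?implybT // powR_inv1 ?ler0n.
  have -> : alpha + 1 + (n t - m)%:R = c2 + (n t)%:R by rewrite natrB // /c2; ring.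
  have -> : 1 + alpha + beta + (n t - m)%:R = c1 + (n t)%:R by rewrite natrB // /c1; ring.
  rewrite -/c2; move: (_ `^ _) ((-1) ^+ m) (Q t nk) => P s q0.
  have h0 : (n t)%:R != 0 :> R[i] by rewrite pnatr_eq0 -lt0n (leq_ltn_trans _ nk).
  move: q0; move: (c2 + (n t)%:R) => q; move: (c1 + (n t)%:R) (c2) => r d q0.
  have h5 : q%:C != 0 :> R[i] by rewrite eq_complex /= (gt_eqF q0).
  rewrite !(rmorphM, fmorphV, rmorphXn, rmorph_nat).
  by field; rewrite h0 h5.
have H := near_eq_cvg E'; exact: cvg_trans (H _) U.
Qed.
End lim.
End ExceptionalJacobi.

Theorem proposition5p7 (R : realType) (m : nat) (alpha beta : R)
    (halpha : -1 < alpha) (K : set R[i]^o) (hK : compact K) :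
  {uniform K,
    (fun (n : nat) (z : R[i]^o) =>
       (n%:R `^ (- alpha))%:C
         * horner_complex (xjacobi alpha beta m n) (cosC (z / n%:R)) : R[i]^o) @ \oo
    --> (fun z : R[i]^o =>
       ((-1) ^+ m * gbinom (m%:R - 1 - alpha) m)%:C
         * bessel_entire alpha z : R[i]^o)}.
Proof.
apply: uniform_of_joint_cvg => // z0.
apply: (cvg_xjacobi m alpha beta snd fst z0 halpha); [exact: cvg_snd|exact: cvg_fst].
Qed.
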